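(* In the setting of the context, fix $x\in\mathcal X$ (write $\ell_k(z)=\ell_k(x,z)$), $i\in[N]$, $b_i\in\mathbb R_+$ and $1\le k_1<k_2\le K$. Suppose the regularity assumption and the local worst-case oracle assumption hold. Then the algorithm PairEval described in the context, run with oracle precision $\epsilon>0$ and golden-section tolerance $\eta>0$, returns a feasible local solution $\hat s$ (a feasible point $(\alpha_1,\alpha_2,\beta_1,\beta_2,v_1,v_2)$ of the problem defining $V_i^{(k_1,k_2)}(b_i)$) and a value $\hat V_i^{(k_1,k_2)}(b_i)$ satisfying $$\Big|V_i^{(k_1,k_2)}(b_i)-\hat V_i^{(k_1,k_2)}(b_i)\Big|\le\begin{cases}O\big(\epsilon+\eta^{\min\{1/p,\,1-1/p\}}\big)&\text{if }p>1,\\ O\big(\epsilon+\eta^{1-r}\big)&\text{if }p=1,\end{cases}$$ with the running time complexity of $$\widetilde O\big((\mathsf{Cost}_{k_1,\epsilon}+\mathsf{Cost}_{k_2,\epsilon})\log^2(1/\eta)\big).$$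
   Context: Notation: $[n]=\{1,\dots,n\}$; $\mathcal P(\mathcal Z)$ is the set of Borel probability measures on $\mathcal Z$; $\phi=\frac{\sqrt5-1}2$. In the error bounds, the constants in $O(\cdot)$ depend on the remaining problem data (including $b_i$) but not on $\epsilon,\eta$; $\widetilde O$ suppresses logarithmic factors. Setting. $\mathcal X\subseteq\mathbb R^n$, $\mathcal Z\subseteq\mathbb R^m$. A transportation cost $c:\mathcal Z\times\mathcal Z\to\mathbb R_+$ is lower semicontinuous, satisfies $c(z,z)=0$ for all $z$, and $c(\cdot,\hat z)$ is convex for every fixed $\hat z\in\mathcal Z$. The optimal transport discrepancy is $\mathrm{OT}_c(\mathbb P,\mathbb Q)=\min_{\gamma}\mathbb E_{(z,\hat z)\sim\gamma}[c(z,\hat z)]$ over couplings $\gamma$ of $\mathbb P$ and $\mathbb Q$. Given $\hat z_1,\dots,\hat z_N\in\mathcal Z$, let $\hat{\mathbb P}=\frac1N\sum_{i=1}^N\delta_{\hat z_i}$; given $\rho>0$, let $\mathcal P=\{\mathbb P\in\mathcal P(\mathcal Z):\mathrm{OT}_c(\mathbb P,\hat{\mathbb P})\le\rho\}$. Regularity assumption. (i) $\mathcal X$ is nonempty and convex; there exist $\mathbb Q_0\in\mathcal P$ and $x_0\in\mathcal X$ such that $x\mapsto\mathbb E_{z\sim\mathbb Q_0}[\ell(x,z)]$ is inf-compact on $\mathcal X$ (all sublevel sets are compact) and $\mathbb E_{z\sim\mathbb Q_0}[\ell(x_0,z)]>-\infty$; $\mathcal Z$ is nonempty, closed and convex. (ii)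 $\ell(x,z)=\max_{k\in[K]}\ell_k(x,z)$ with $K\ge2$, where each $\ell_k:\mathbb R^n\times\mathbb R^m\to\mathbb R$ is real-valued, convex in its first and concave in its second argument. (iii) There exist a norm $\|\cdot\|$ on $\mathbb R^m$ and $p\ge1$ with $c(z,\hat z)\ge\|z-\hat z\|^p$ for all $z,\hat z\in\mathcal Z$; moreover, if $p=1$, then for every $x\in\mathcal X$ there exist $g>0$, $\hat z_0\in\mathcal Z$ and $r\in[0,1)$ such that $\ell(x,z)\le g[1+\|z-\hat z_0\|^r]$. Local worst-case oracle assumption. For any $k\in[K]$, $\hat z\in\mathcal Z$, radius $u\ge0$ and accuracy $\epsilon>0$ there is an algorithm, denoted $(\hat L,\hat v)\gets\mathsf{WCO}_k^\epsilon(\hat z,u)$, running in time $\mathsf{Cost}_{k,\epsilon}$ that returns $\hat v\in\mathbb R^m$ with $\hat z+\hat v\in\mathcal Z$, $c(\hat z+\hat v,\hat z)\le u$, together with $\hat L=\ell_k(\hat z+\hat v)$ satisfying $\hat L\ge\max\{\ell_k(\hat z+v):v\in\mathbb R^m,\hat z+v\in\mathcal Z,c(\hat z+v,\hat z)\le u\}-\epsilon$. Pairwise utility. $V_i^{(k_1,k_2)}(b)$ is the maximum of $\alpha_1\ell_{k_1}(\hat z_i+v_1)+\alpha_2\ell_{k_2}(\hat z_i+v_2)$ over $\alpha_j,\beta_j\in\mathbb R_+$, $v_j\in\mathbb R^m$ with $\hat z_i+v_j\in\mathcal Z$, $\alpha_jc(\hat z_i+v_j,\hat z_i)\le\beta_j$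 ($j=1,2$), $\alpha_1+\alpha_2=1$, $\beta_1+\beta_2=b$. Algorithms (both use the same $\eta,\epsilon$). InnerSolver$(i,k_1,k_2,b_i,\alpha_1)$ with $\alpha_1\in(0,1)$: set $\alpha_2=1-\alpha_1$, $L=0$, $U=b_i$, $\beta^{(1)}=U-\phi(U-L)$, $\beta^{(2)}=L+\phi(U-L)$. While $U-L>\eta$: for $j=1,2$ call $(L_1^{(j)},v_1^{(j)})\gets\mathsf{WCO}^\epsilon_{k_1}(\hat z_i,\beta^{(j)}/\alpha_1)$, $(L_2^{(j)},v_2^{(j)})\gets\mathsf{WCO}^\epsilon_{k_2}(\hat z_i,(b_i-\beta^{(j)})/\alpha_2)$ and set $V^{(j)}=\alpha_1L_1^{(j)}+\alpha_2L_2^{(j)}$; if $V^{(1)}<V^{(2)}$, set $L\gets\beta^{(1)}$, $\beta^{(1)}\gets\beta^{(2)}$, $\beta^{(2)}\gets L+\phi(U-L)$; otherwise set $U\gets\beta^{(2)}$, $\beta^{(2)}\gets\beta^{(1)}$, $\beta^{(1)}\gets U-\phi(U-L)$. Finally choose $j^\star\in\arg\max_jV^{(j)}$ and return the value $V^{(j^\star)}$ and the optimizer $(\alpha_1,\alpha_2,\beta^{(j^\star)},b_i-\beta^{(j^\star)},v_1^{(j^\star)},v_2^{(j^\star)})$, where $\beta^{(j^\star)}$ is the point at which $V^{(j^\star)}$ was evaluated. PairEval$(i,k_1,k_2,b_i)$: set $L=0$, $U=1$, $\alpha^{(1)}=U-\phi(U-L)$, $\alpha^{(2)}=L+\phi(U-L)$.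 While $U-L>\eta$: for $j=1,2$ let $(V^{(j)},s^{(j)})$ be the output of InnerSolver$(i,k_1,k_2,b_i,\alpha^{(j)})$; if $V^{(1)}<V^{(2)}$, set $L\gets\alpha^{(1)}$, $\alpha^{(1)}\gets\alpha^{(2)}$, $\alpha^{(2)}\gets L+\phi(U-L)$; otherwise set $U\gets\alpha^{(2)}$, $\alpha^{(2)}\gets\alpha^{(1)}$, $\alpha^{(1)}\gets U-\phi(U-L)$. Finally choose $j^\star\in\arg\max_jV^{(j)}$ and return $\hat V_i^{(k_1,k_2)}(b_i)=V^{(j^\star)}$ and $\hat s=s^{(j^\star)}$. *)

(* Defs.v *)
From HB Require Import structures.
From mathcomp Require Import all_boot all_order all_algebra.
From mathcomp Require Import all_classical all_reals all_analysis.
Set Implicit Arguments.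
Unset Strict Implicit.
Unset Printing Implicit Defensive.
Import Order.TTheory GRing.Theory Num.Theory.
Import numFieldNormedType.Exports.
Local Open Scope classical_set_scope.
Local Open Scope ring_scope.

(* R^m with its Borel sigma-algebra *)
Notation borel_rV R m := (g_sigma_algebraType (@open 'rV[R]_m)).

Section optimal_transport.
Context {R : realType} {m : nat}.
Local Notation V := 'rV[R]_m.
Local Notation BV := (borel_rV R m).

(* Measures on Z are measures on R^m giving mass 1 to the (closed) set Z;
   functions of points of Z are total functions on R^m that are constrained and
   used on Z only. *)
Definition on_support (Z : set V) (P : probability BV R) :=
  P (Z : set BV) = 1%E.

Definition is_coupling (P Q : set BV -> \bar R)
    (g : probability (BV * BV)%type R) :=
  (forall A, measurable A -> g (A `*` setT) = P A) /\
  (forall B, measurable B -> g (setT `*` B) = Q B).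

Definition OT (Z : set V) (c : V -> V -> R) (P Q : set BV -> \bar R)
    : \bar R :=
  ereal_inf [set (\int[g]_(q in Z `*` Z) (c q.1 q.2)%:E)%E
            | g in [set g | is_coupling P Q g]].

Definition empirical (N : nat) (zhat : 'I_N -> V) (A : set BV) : \bar R :=
  ((N%:R^-1)%:E * \sum_(i < N) \d_(zhat i : BV) A)%E.

Definition ambiguity_set (Z : set V) (c : V -> V -> R) (N : nat)
    (zhat : 'I_N -> V) (rho : R) : set (probability BV R) :=
  [set P | on_support Z P /\ (OT Z c P (empirical zhat) <= rho%:E)%E].

Definition transportation_cost (Z : set V) (c : V -> V -> R) : Prop :=
  [/\ (forall z z', Z z -> Z z' -> 0 <= c z z'),
      (forall z, Z z -> c z z = 0),
      (forall z', Z z' -> convex_function Z (fun z => c z z'))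
    & lower_semicontinuous
        (fun q : subspace (Z `*` Z) => (c (q : V * V).1 (q : V * V).2)%:E)].

Definition is_norm (nrm : V -> R) : Prop :=
  [/\ (forall v w, nrm (v + w) <= nrm v + nrm w),
      (forall a v, nrm (a *: v) = `|a| * nrm v)
    & (forall v, nrm v = 0 -> v = 0)].

End optimal_transport.

Section regularity.
Context {R : realType} {n m K N : nat}.
Local Notation V := 'rV[R]_m.
Variables (X : set 'rV[R]_n) (Z : set V) (c : V -> V -> R).
Variable ell : 'I_K -> 'rV[R]_n -> V -> R.
Variables (zhat : 'I_N -> V) (rho : R) (nrm : V -> R) (p : R).

(* The value -oo of the empty maximum is irrelevant, since 2 <= K. *)
Definition loss (x : 'rV[R]_n) (z : V) : \bar R :=
  \big[maxe/-oo%E]_(k < K) (ell k x z)%:E.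

Definition expected_loss (Q : probability (borel_rV R m) R) (x : 'rV[R]_n)
    : \bar R :=
  (\int[Q]_(z in (Z : set (borel_rV R m))) loss x z)%E.

Definition sublinear_growth (x : 'rV[R]_n) (g : R) (z0 : V) (r : R) : Prop :=
  [/\ 0 < g, Z z0, 0 <= r < 1
    & forall z, Z z -> (loss x z <= (g * (1 + nrm (z - z0) `^ r))%:E)%E].

Record regularity_assumption : Prop := RegularityAssumption {
  reg_X_nonempty : X !=set0;
  reg_X_convex : convex_set X;
  reg_inf_compact : exists Q0 x0,
    [/\ ambiguity_set Z c zhat rho Q0, X x0,
        (forall t : R,
           compact (X `&` [set x | (expected_loss Q0 x <= t%:E)%E]))
      & (-oo < expected_loss Q0 x0)%E];
  reg_Z_nonempty : Z !=set0;
  reg_Z_closed : closed Z;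
  reg_Z_convex : convex_set Z;
  reg_K : (2 <= K)%N;
  reg_ell_convex : forall k z, convex_function setT (fun x => ell k x z);
  reg_ell_concave : forall k x, convex_function setT (fun z => - ell k x z);
  reg_norm : is_norm nrm;
  reg_p : 1 <= p;
  reg_cost_lb : forall z z', Z z -> Z z' -> nrm (z - z') `^ p <= c z z';
  reg_growth : p = 1 -> forall x, X x -> exists g z0 r, sublinear_growth x g z0 r
}.

Definition error_exponent (x : 'rV[R]_n) (theta : R) : Prop :=
  (1 < p /\ theta = Num.min p^-1 (1 - p^-1)) \/
  (p = 1 /\ exists g z0 r, sublinear_growth x g z0 r /\ theta = 1 - r).

End regularity.

Record local_solution (R : realType) (m : nat) := LocalSolution {
  ls_alpha1 : R; ls_alpha2 : R;
  ls_beta1 : R; ls_beta2 : R;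
  ls_v1 : 'rV[R]_m; ls_v2 : 'rV[R]_m
}.

Section pairwise_utility.
Context {R : realType} {m : nat}.
Local Notation V := 'rV[R]_m.
Variables (Z : set V) (c : V -> V -> R) (l1 l2 : V -> R) (zh : V) (b : R).

Definition pair_feasible (s : local_solution R m) : Prop :=
  let: LocalSolution a1 a2 b1 b2 v1 v2 := s in
  [/\ [/\ 0 <= a1, 0 <= a2, 0 <= b1 & 0 <= b2],
      Z (zh + v1) /\ Z (zh + v2),
      a1 * c (zh + v1) zh <= b1 /\ a2 * c (zh + v2) zh <= b2,
      a1 + a2 = 1
    & b1 + b2 = b].

Definition pair_objective (s : local_solution R m) : R :=
  ls_alpha1 s * l1 (zh + ls_v1 s) + ls_alpha2 s * l2 (zh + ls_v2 s).

Definition pair_utility : R :=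
  sup [set pair_objective s | s in [set s | pair_feasible s]].

End pairwise_utility.

(* [wco k eps zh u] is the pair (L, v) returned by the oracle for piece k; the
   oracle being an algorithm, its answer is a function of its input. [cost k eps]
   is the number of elementary steps charged for one call (at least one). *)
Definition wc_oracle {R : realType} {m K : nat} (Z : set 'rV[R]_m)
    (c : 'rV[R]_m -> 'rV[R]_m -> R) (l : 'I_K -> 'rV[R]_m -> R)
    (wco : 'I_K -> R -> 'rV[R]_m -> R -> R * 'rV[R]_m)
    (cost : 'I_K -> R -> nat) : Prop :=
  forall k eps, 0 < eps ->
    (0 < cost k eps)%N /\
    forall zh u, Z zh -> 0 <= u ->
      let: (L, v) := wco k eps zh u in
      [/\ Z (zh + v), c (zh + v) zh <= u, L = l k (zh + v)
        & sup [set l k (zh + w) | w in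
                 [set w | Z (zh + w) /\ c (zh + w) zh <= u]] - eps <= L].

Section golden_section.
Context {R : realType} {A : Type}.

Definition golden_ratio : R := (Num.sqrt 5 - 1) / 2.

(* [ev y o t]: evaluating the objective at y may return o = (value, optimizer)
   in t elementary steps. Below, each real arithmetic operation, each comparison
   of reals and each oracle step counts for one step; assignments are free. *)
Variables (ev : R -> R * A -> nat -> Prop) (eta : R).

(* [gs_last] holds the results of the latest pass, if there was one. *)
Record gs_state := GSState {
  gs_L : R; gs_U : R; gs_y1 : R; gs_y2 : R;
  gs_last : option ((R * A) * (R * A))
}.

Definition gs_init (L U : R) : gs_state :=
  GSState L U (U - golden_ratio * (U - L)) (L + golden_ratio * (U - L)) None.

Definition gs_update (s : gs_state) (o1 o2 : R * A) : gs_state :=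
  let: GSState L U y1 y2 _ := s in
  if o1.1 < o2.1
  then GSState y1 U y2 (y1 + golden_ratio * (U - y1)) (Some (o1, o2))
  else GSState L y2 (y2 - golden_ratio * (y2 - L)) y1 (Some (o1, o2)).

(* [gs_loop s s' t]: the while loop started in state s stops in s' after t
   steps. The guard costs 2 steps, the comparison and the update cost 4. *)
Inductive gs_loop : gs_state -> gs_state -> nat -> Prop :=
| gs_exit s : gs_U s - gs_L s <= eta -> gs_loop s s 2
| gs_pass s o1 o2 t1 t2 s' t :
    eta < gs_U s - gs_L s ->
    ev (gs_y1 s) o1 t1 -> ev (gs_y2 s) o2 t2 ->
    gs_loop (gs_update s o1 o2) s' t ->
    gs_loop s s' (2 + t1 + t2 + 4 + t)%N.

Definition gs_argmax (o1 o2 o : R * A) : Prop :=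
  (o = o1 /\ o2.1 <= o1.1) \/ (o = o2 /\ o1.1 <= o2.1).

(* If the initial interval is no longer than eta, no pass takes place; the two
   initial points are then evaluated once, so that an output is always defined. *)
Inductive gs_return (s : gs_state) : R * A -> nat -> Prop :=
| gs_return_last o1 o2 o :
    gs_last s = Some (o1, o2) -> gs_argmax o1 o2 o -> gs_return s o 1
| gs_return_fresh o1 o2 t1 t2 o :
    gs_last s = None -> ev (gs_y1 s) o1 t1 -> ev (gs_y2 s) o2 t2 ->
    gs_argmax o1 o2 o -> gs_return s o (t1 + t2 + 1)%N.

Definition golden_section (L U : R) (o : R * A) (t : nat) : Prop :=
  exists s t1 t2,
    [/\ gs_loop (gs_init L U) s t1, gs_return s o t2 & t = (6 + t1 + t2)%N].

End golden_section.

Section algorithms.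
Context {R : realType} {m K : nat}.
Local Notation V := 'rV[R]_m.
Variables (wco : 'I_K -> R -> V -> R -> R * V) (cost : 'I_K -> R -> nat).
Variables (eps eta : R) (zh : V) (k1 k2 : 'I_K) (b : R).

(* 6 arithmetic operations besides the two oracle calls *)
Definition inner_eval (a1 beta : R) (o : R * local_solution R m) (t : nat)
    : Prop :=
  let a2 := 1 - a1 in
  let: (L1, v1) := wco k1 eps zh (beta / a1) in
  let: (L2, v2) := wco k2 eps zh ((b - beta) / a2) in
  o = (a1 * L1 + a2 * L2, LocalSolution a1 a2 beta (b - beta) v1 v2) /\
  t = (cost k1 eps + cost k2 eps + 6)%N.

(* The extra step computes 1 - a1. *)
Definition inner_solver (a1 : R) (o : R * local_solution R m) (t : nat)
    : Prop :=
  exists2 t0, golden_section (inner_eval a1) eta 0 b o t0 & t = (1 + t0)%N.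

Definition pair_eval (o : R * local_solution R m) (t : nat) : Prop :=
  golden_section inner_solver eta 0 1 o t.

End algorithms.

(* f = soft-O(g) when f <= C * g * log^q for some C and q; the logarithm
   is shifted so as to be nonnegative. *)
Definition soft_O_bound {R : realType} (C : R) (q : nat) (g : R) : R :=
  C * g * (1 + ln (1 + g)) ^+ q.

(* Main.v *)
(* With g_k(u) the largest value of l_k over the transport ball of radius u, the
   value of the pair problem is the maximum over (alpha, beta) of
     alpha g_1(beta / alpha) + (1 - alpha) g_2((b - beta) / (1 - alpha)),
   a jointly concave function since each g_k is concave and its perspective is
   superadditive and homogeneous. A golden-section search driven by values that
   are exact up to e loses at most 3e through misleading comparisons: when a
   wrong part is discarded, concavity bounds what lies in it by the retained
   value plus 3e, and since repeated queries get equal answers, the best value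
   seen is never lost, so these losses do not accumulate over the passes. What
   remains is the variation of the objective over an interval of length eta.
   Since a concave function grows at most linearly and c >= |.|^p, we have
   g_k(u) - g_k(0) <= G u^tau and <= G u^sigma, with tau = sigma = 1/p if p > 1,
   and tau = 1, sigma = r if p = 1; this yields the modulus eta^tau in beta,
   uniformly in alpha, and eta^(1 - sigma) in alpha. *)
Require Import Defs.
From mathcomp Require Import all_boot all_order all_algebra.
From mathcomp Require Import all_classical all_reals all_analysis.
From mathcomp Require Import ring lra.
Import Order.TTheory GRing.Theory Num.Theory.
Import numFieldNormedType.Exports.
Local Open Scope classical_set_scope.
Local Open Scope ring_scope.

Set Implicit Arguments.
Unset Strict Implicit.
Unset Printing Implicit Defensive.

(** * Golden-section search with inexact values *)

Section golden_ratio_facts.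
Context {R : realType}.
Local Notation phi := (golden_ratio : R).

Lemma golden_ratio_sq : phi * phi = 1 - phi.
Proof.
have h : Num.sqrt (5 : R) * Num.sqrt 5 = 5 by rewrite -expr2 sqr_sqrtr.
rewrite /golden_ratio; set s := Num.sqrt _ in h *; lra.
Qed.

Lemma golden_ratio_bounds : 1 / 2 < phi < 2 / 3.
Proof.
have h : Num.sqrt (5 : R) ^+ 2 = 5 by rewrite sqr_sqrtr.
have s0 : 0 <= Num.sqrt (5 : R) by apply: sqrtr_ge0.
rewrite /golden_ratio; set s := Num.sqrt _ in h s0 *.
have : 2 < s by rewrite -(ltr_pXn2r (n := 2)) ?nnegrE // h; lra.
have : s < 7 / 3 by rewrite -(ltr_pXn2r (n := 2)) ?nnegrE // ?h; lra.
lra.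
Qed.

End golden_ratio_facts.

Section golden_section_run.
Context {R : realType} {A : Type}.
Local Notation phi := (golden_ratio : R).
Variables (ev : R -> R * A -> nat -> Prop) (eta L0 U0 : R).
Hypotheses (eta_gt0 : 0 < eta) (L0U0 : L0 <= U0).
Local Notation state := (@gs_state R A).

(* Strict inequalities keep the outer search away from alpha = 0 and alpha = 1,
   but fail for the inner search when its interval [0, b] is degenerate. *)
Definition inside (y : R) : Prop := L0 <= y <= U0 /\ (L0 < U0 -> L0 < y < U0).

Definition gs_inv (s : state) : Prop :=
  [/\ L0 <= gs_L s, gs_U s <= U0, gs_L s <= gs_U s /\ (L0 < U0 -> gs_L s < gs_U s),
      gs_y1 s = gs_U s - phi * (gs_U s - gs_L s)
    & gs_y2 s = gs_L s + phi * (gs_U s - gs_L s)].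

Definition gs_len (s : state) : R := gs_U s - gs_L s.

Lemma gs_inv_init : gs_inv (gs_init L0 U0).
Proof. by split. Qed.

Lemma gs_inv_inside s : gs_inv s -> inside (gs_y1 s) /\ inside (gs_y2 s).
Proof.
case: s => L U y1 y2 last [/= h1 h2 [h3 h3'] -> ->].
have /andP[p1 p2] := @golden_ratio_bounds R.
split; split; first [nra | move=> /h3' h; nra].
Qed.

Lemma gs_inv_update (s : state) o1 o2 : gs_inv s -> gs_inv (gs_update s o1 o2).
Proof.
case: s => L U y1 y2 last [/= h1 h2 [h3 h3'] e1 e2].
have /andP[p1 p2] := @golden_ratio_bounds R.
have p3 := @golden_ratio_sq R.
case: ifP => _; split=> //=; subst y1 y2.
- nra.
- by split=> [|/h3' h]; nra.
- by transitivity (U - phi * phi * (U - L)); [rewrite p3; ring | ring].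
- nra.
- by split=> [|/h3' h]; nra.
- by transitivity (L + phi * phi * (U - L)); [rewrite p3; ring | ring].
Qed.

Lemma gs_len_update (s : state) o1 o2 :
  gs_inv s -> gs_len (gs_update s o1 o2) = phi * gs_len s.
Proof.
case: s => L U y1 y2 last [/= h1 h2 [h3 h3'] e1 e2]; rewrite /gs_len.
by case: ifP => _ /=; rewrite ?e1 ?e2; ring.
Qed.

Lemma gs_last_update (s : state) o1 o2 : gs_last (gs_update s o1 o2) = Some (o1, o2).
Proof. by case: s => * /=; case: ifP. Qed.

Definition attained (o : R * A) : Prop := exists y t, inside y /\ ev y o t.

Lemma gs_loop_attained s s' t : gs_loop ev eta s s' t -> gs_inv s ->
  (forall o1 o2, gs_last s = Some (o1, o2) -> attained o1 /\ attained o2) ->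
  gs_inv s' /\
  (forall o1 o2, gs_last s' = Some (o1, o2) -> attained o1 /\ attained o2).
Proof.
elim=> {s s' t} [s //|s o1 o2 t1 t2 s' t _ e1 e2 _ IH si hs].
apply: IH; first exact: gs_inv_update.
move=> a1 a2; rewrite gs_last_update => -[<- <-].
by have [i1 i2] := gs_inv_inside si; split; [exists (gs_y1 s), t1|exists (gs_y2 s), t2].
Qed.

Lemma golden_section_attained o t : golden_section ev eta L0 U0 o t -> attained o.
Proof.
case=> s [t1 [t2 [lp rt _]]].
have [|si hs] := gs_loop_attained lp gs_inv_init; first by [].
case: rt => [ o1 o2 o' hl| o1 o2 s1 s2 o' _ e1 e2].
  by have [? ?] := hs _ _ hl; case=> -[-> _].
have [i1 i2] := gs_inv_inside si.
by case=> -[-> _]; [exists (gs_y1 s), s1|exists (gs_y2 s), s2].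
Qed.

Lemma gs_loop_total s n : gs_inv s -> phi ^+ n * gs_len s <= eta ->
  (forall y, exists o t, ev y o t) -> exists s' t, gs_loop ev eta s s' t.
Proof.
move=> + + tot; elim: n s => [|n IH] s si hn.
  by exists s, 2%N; apply: gs_exit; rewrite expr0 mul1r in hn.
have [le|lt] := leP (gs_U s - gs_L s) eta; first by exists s, 2%N; apply: gs_exit.
have [ o1 [t1 e1]] := tot (gs_y1 s).
have [ o2 [t2 e2]] := tot (gs_y2 s).
have [|s' [t h]] := IH _ (gs_inv_update o1 o2 si).
  by rewrite gs_len_update // mulrA -exprSr.
by exists s', (2 + t1 + t2 + 4 + t)%N; apply: gs_pass h.
Qed.

Lemma golden_ratio_pow_small (d : R) : 0 <= d -> exists n, phi ^+ n * d <= eta.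
Proof.
move=> d0; have /andP[p1 p2] := @golden_ratio_bounds R.
have p3 := @golden_ratio_sq R.
have [n hn] : exists n, d / eta < n%:R :> R.
  by exists (Num.bound (d / eta)); apply: archi_boundP; rewrite divr_ge0 // ltW.
exists (n + n)%N.
have h2 : phi ^+ (n + n) * n%:R <= 1.
  rewrite exprD -exprMn p3.
  have : (1 - phi) ^+ n <= 2^-1 ^+ n by apply: lerXn2r; rewrite ?nnegrE; lra.
  have q : n%:R <= (2 : R) ^+ n by rewrite -natrX ler_nat ltnW // ltn_expl.
  have q0 : 0 < (2 : R) ^+ n by rewrite exprn_gt0.
  move=> h; apply: (@le_trans _ _ (2^-1 ^+ n * 2 ^+ n)).
    by apply: ler_pM => //; rewrite exprn_ge0 //; lra.
  by rewrite -exprMn mulVf // expr1n.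
have q0 : 0 <= phi ^+ (n + n) by rewrite exprn_ge0 //; lra.
move: hn; rewrite ltr_pdivrMr // => hn.
apply: (le_trans (ler_wpM2l q0 (ltW hn))).
by rewrite mulrA ler_piMl // ltW.
Qed.

Lemma golden_section_total :
  (forall y, exists o t, ev y o t) -> exists o t, golden_section ev eta L0 U0 o t.
Proof.
move=> tot.
have [n hn] : exists n, phi ^+ n * gs_len (gs_init L0 U0 : state) <= eta.
  by apply: golden_ratio_pow_small; rewrite subr_ge0.
have [s [t1 lp]] := gs_loop_total gs_inv_init hn tot.
have amax o1 o2 : exists o : R * A, gs_argmax o1 o2 o.
  by have [h|/ltW h] := leP o2.1 o1.1; [exists o1; left|exists o2; right].
suff [ o [t2 rt]] : exists o t, gs_return ev s o t.
  by exists o, (6 + t1 + t2)%N, s, t1, t2.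
case E : (gs_last s) => [[ o1 o2]|].
  by have [ o ho] := amax o1 o2; exists o, 1%N; apply: gs_return_last E ho.
have [ o1 [s1 e1]] := tot (gs_y1 s); have [ o2 [s2 e2]] := tot (gs_y2 s).
by have [ o ho] := amax o1 o2; exists o, (s1 + s2 + 1)%N; apply: gs_return_fresh ho.
Qed.

Lemma gs_loop_time (c : R) (s s' : state) t : gs_loop ev eta s s' t -> gs_inv s ->
  (forall y o t, inside y -> ev y o t -> t%:R <= c) ->
  exists k, t%:R <= 2 + k%:R * (6 + 2 * c) /\
            (k = 0%N \/ eta < phi ^+ k.-1 * gs_len s).
Proof.
move=> + + hc; elim=> {s s' t} [s _ _|s o1 o2 t1 t2 s' t lt e1 e2 _ IH si].
  by exists 0%N; split; [lra|left].
have [i1 i2] := gs_inv_inside si.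
have [k [tk hk]] := IH (gs_inv_update o1 o2 si).
exists k.+1; split.
  have := hc _ _ _ i1 e1; have := hc _ _ _ i2 e2.
  by rewrite !natrD -natr1 mulrDl mul1r; lra.
right => /=; case: hk => [->|]; first by rewrite expr0 mul1r.
rewrite gs_len_update //; case: k {tk} => [|k] /=; last by rewrite mulrA -exprSr.
have /andP[p1 p2] := @golden_ratio_bounds R.
by rewrite !expr0 !mul1r; rewrite /gs_len in lt *; nra.
Qed.

Lemma golden_section_time (c : R) o t : golden_section ev eta L0 U0 o t -> 0 <= c ->
  (forall y o t, inside y -> ev y o t -> t%:R <= c) ->
  exists k, t%:R <= k.+1%:R * (2 * c + 9) /\
            (k = 0%N \/ eta < phi ^+ k.-1 * (U0 - L0)).
Proof.
case=> s [t1 [t2 [lp rt ->]]] c0 hc.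
have [|si _] := gs_loop_attained lp gs_inv_init; first by [].
have [k [tk hk]] := gs_loop_time lp gs_inv_init hc.
exists k; split=> //.
have h2 : t2%:R <= 2 * c + 1.
  case: rt => [*| o1 o2 s1 s2 o' _ e1 e2 _]; first by lra.
  have [i1 i2] := gs_inv_inside si.
  have := hc _ _ _ i1 e1; have := hc _ _ _ i2 e2.
  by rewrite !natrD; lra.
rewrite !natrD -natr1 mulrDl mul1r.
have : k%:R * (6 + 2 * c) <= k%:R * (2 * c + 9) by rewrite ler_wpM2l //; lra.
by lra.
Qed.

Lemma gs_loop_det s s1 s2 t1 t2 :
  (forall y o o' t t', ev y o t -> ev y o' t' -> o = o') ->
  gs_loop ev eta s s1 t1 -> gs_loop ev eta s s2 t2 -> s1 = s2.
Proof.
move=> det h; elim: h s2 t2 => {s s1 t1} [s le|s o1 o2 t1 t2 s' t lt e1 e2 _ IH] s2 u h.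
  inversion h; subst=> //.
  by have := lt_le_trans H le; rewrite ltxx.
inversion h; subst.
  by have := lt_le_trans lt H; rewrite ltxx.
apply: (IH _ t4).
by rewrite (det _ _ _ _ _ e1 H0) (det _ _ _ _ _ e2 H1).
Qed.

Lemma golden_section_det o o' t t' :
  (forall y o o' t t', ev y o t -> ev y o' t' -> o = o') ->
  golden_section ev eta L0 U0 o t -> golden_section ev eta L0 U0 o' t' ->
  o.1 = o'.1.
Proof.
move=> det [s [t1 [t2 [lp rt _]]]] [s' [t1' [t2' [lp' rt' _]]]].
have E := gs_loop_det det lp lp'; subst s'.
have amax (o1 o2 a a' : R * A) : gs_argmax o1 o2 a -> gs_argmax o1 o2 a' -> a.1 = a'.1.
  by case=> -[-> h1] [] [-> h2] //; apply/le_anti; rewrite h1 h2.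
case: rt => [ o1 o2 {}o hl hm| o1 o2 s1 s2 {}o hl e1 e2 hm];
  case: rt' => [p1 p2 {}o' hl' hm'|p1 p2 s1' s2' {}o' hl' e1' e2' hm'].
- by move: hl'; rewrite hl => -[? ?]; subst p1 p2; apply: amax hm hm'.
- by rewrite hl in hl'.
- by rewrite hl in hl'.
- rewrite (det _ _ _ _ _ e1' e1) (det _ _ _ _ _ e2' e2) in hm'.
  exact: amax hm hm'.
Qed.

Section error.
Variables (H : R -> R -> Prop) (e : R).
Hypothesis H_conv : forall y v y' v' (t : R), H y v -> H y' v' -> 0 <= t <= 1 ->
  H (t * y + (1 - t) * y') (t * v + (1 - t) * v').
Hypothesis ev_det : forall y o o' t t', ev y o t -> ev y o' t' -> o.1 = o'.1.
Hypothesis ev_hypo : forall y o t, inside y -> ev y o t ->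
  H y o.1 /\ forall v, H y v -> v <= o.1 + e.
Hypothesis e_ge0 : 0 <= e.

(* y1 divides [x, y2] in a ratio bounded below by golden_ratio^2 > 1/3, so a
   misleading comparison of y1 and y2 costs at most 3e by concavity. *)
Lemma discarded_bound (x v y1 y2 w1 w2 : R) :
  H x v -> H y2 w2 -> (forall w, H y1 w -> w <= w1 + e) -> w1 <= w2 ->
  (x < y1 < y2 /\ y2 - x <= 3 * (y2 - y1)) \/
  (y2 < y1 < x /\ x - y2 <= 3 * (y1 - y2)) ->
  v <= w2 + 3 * e.
Proof.
move=> hx h2 h1 w12 hd.
pose t := (y2 - y1) / (y2 - x).
have d0 : y2 - x != 0 by case: hd => -[/andP[a b] _]; apply/eqP; lra.
have tE : t * (y2 - x) = y2 - y1 by rewrite /t divfK.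
have /andP[t3 t1] : 1 / 3 <= t <= 1.
  by apply/andP; split; case: hd => -[/andP[a b] c]; nra.
have h := H_conv hx h2 (t := t).
have : t * v + (1 - t) * w2 <= w1 + e.
  apply: h1; rewrite (_ : y1 = t * x + (1 - t) * y2); last first.
    by move: tE; lra.
  by apply: h; lra.
have e0 := e_ge0; move=> le1; have [le2|/ltW le2] := leP v w2; first by lra.
nra.
Qed.

Definition gs_progress (x v : R) (s : state) : Prop :=
  match gs_last s with
  | None => gs_L s <= x <= gs_U s
  | Some (o1, o2) => let w := Num.max o1.1 o2.1 in
      (exists y o t, [/\ y = gs_y1 s \/ y = gs_y2 s, ev y o t & o.1 = w]) /\
      (v <= w + 3 * e \/ gs_L s <= x <= gs_U s)
  end.

(* As the oracle answers the same query always in the same way, the best value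
   found so far is found again in every later pass. *)
Lemma gs_progress_update x v s o1 o2 t1 t2 : gs_inv s -> eta < gs_len s -> H x v ->
  ev (gs_y1 s) o1 t1 -> ev (gs_y2 s) o2 t2 ->
  gs_progress x v s -> gs_progress x v (gs_update s o1 o2).
Proof.
move=> si; have [i1 i2] := gs_inv_inside si.
rewrite {2}/gs_progress gs_last_update.
case: s si i1 i2 => L U y1 y2 last /= si i1 i2 lt hx e1 e2.
have [H1 H1'] := ev_hypo i1 e1; have [H2 H2'] := ev_hypo i2 e2.
have /andP[p1 p2] := @golden_ratio_bounds R.
have lU : 0 < U - L by apply: lt_trans lt.
rewrite /gs_progress /= => P.
have {}P : v <= Num.max o1.1 o2.1 + 3 * e \/ L <= x <= U.
  case: last si lt P => [[q1 q2]|] si lt; last by right.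
  move=> [[y [ o [t [hy ey <-]]]] [hv|hv]]; [left|by right].
  apply: le_trans hv _; rewrite lerD2r le_max.
  by case: hy => E; rewrite E in ey; rewrite ?(ev_det ey e1) ?(ev_det ey e2) lexx ?orbT.
case: si => /= h1 h2 _ E1 E2.
have p3 : phi * (U - L) * phi = (U - L) * (1 - phi) by rewrite -golden_ratio_sq; ring.
move: P; have [lt12|le21] := ltP o1.1 o2.1 => /= P.
- split.
    exists y2, o2, t2; split=> //; first by left.
  case: P => [|hxx]; first by left.
  have [xy|yx] := leP y1 x; first by right; lra.
  left; apply: (discarded_bound hx H2 H1' (ltW lt12)); left.
  by split; nra.
- split.
    exists y1, o1, t1; split=> //; first by right.
  case: P => [|hxx]; first by left.
  have [xy|yx] := leP x y2; first by right; lra.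
  left; apply: (discarded_bound hx H1 H2' le21); right.
  by split; nra.
Qed.

Lemma gs_loop_progress x v s s' t : gs_loop ev eta s s' t -> gs_inv s -> H x v ->
  gs_progress x v s -> [/\ gs_inv s', gs_len s' <= eta & gs_progress x v s'].
Proof.
elim=> {s s' t} [s le si hx P //|s o1 o2 t1 t2 s' t lt e1 e2 _ IH si hx P].
apply: IH => //; first exact: gs_inv_update.
by apply: gs_progress_update e1 e2 P.
Qed.

Lemma golden_section_error o t x v :
  golden_section ev eta L0 U0 o t -> L0 <= x <= U0 -> H x v ->
  v <= o.1 + 3 * e \/
  exists y o' t', [/\ inside y, `|x - y| <= eta, ev y o' t' & o'.1 <= o.1].
Proof.
case=> s [t1 [t2 [lp rt _]]] x01 hx.
have [si len P] := gs_loop_progress lp gs_inv_init hx x01.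
have [i1 i2] := gs_inv_inside si.
have close y : y = gs_y1 s \/ y = gs_y2 s -> gs_L s <= x <= gs_U s -> `|x - y| <= eta.
  move=> hy hxs; apply: le_trans len; rewrite ler_distlC /gs_len.
  case: si => h1 h2 [h3 _] E1 E2.
  have /andP[p1 p2] := @golden_ratio_bounds R.
  by case: hy => ->; rewrite ?E1 ?E2; nra.
have ins y : y = gs_y1 s \/ y = gs_y2 s -> inside y by case=> ->.
rewrite /gs_progress in P; case: rt => [ o1 o2 {}o hl hm| o1 o2 s1 s2 {}o hl e1 e2 hm];
  rewrite hl in P.
- have -> : o.1 = Num.max o1.1 o2.1.
    by case: hm => -[-> /[dup] h]; [move/max_idPl|move/max_idPr].
  case: P => [[y [ o' [t' [hy ey ow]]]] [|hxs]]; [by left|right].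
  by exists y, o', t'; split=> //; [exact: ins|exact: close|rewrite ow].
- right; case: hm => -[-> _].
    by exists (gs_y1 s), o1, s1; split=> //; apply: close => //; left.
  by exists (gs_y2 s), o2, s2; split=> //; apply: close => //; right.
Qed.

End error.

End golden_section_run.

Lemma golden_passes_bound {R : realType} (D : R) : 1 <= D ->
  exists2 C : R, 0 < C & forall (eta : R) k, 0 < eta -> eta <= 2^-1 ->
    (k = 0%N \/ eta < golden_ratio ^+ k.-1 * D) -> k.+1%:R <= C * ln eta^-1.
Proof.
move=> D1; have /andP[p1 p2] := @golden_ratio_bounds R.
set phi : R := golden_ratio in p1 p2 *.
pose lam : R := - ln phi; pose l2 : R := ln 2.
have lam0 : 0 < lam by rewrite oppr_gt0 ln_lt0 //; lra.
have l20 : 0 < l2 by rewrite ln_gt0 //; lra.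
have lD0 : 0 <= ln D by rewrite ln_ge0.
have C0 : 0 < 2 / l2 + ln D / (lam * l2) + lam^-1.
  apply: addr_gt0; last by rewrite invr_gt0.
  apply: ltr_wpDr; last by rewrite divr_gt0.
  by rewrite divr_ge0 // mulr_ge0 // ltW.
exists (2 / l2 + ln D / (lam * l2) + lam^-1) => // eta k eta0 eta2 hk.
set X := ln eta^-1.
have X2 : l2 <= X.
  rewrite ler_ln ?posrE ?invr_gt0 // -[leLHS]invrK lef_pV2 ?posrE //.
have E : 2 + (ln D + X) / lam <= (2 / l2 + ln D / (lam * l2) + lam^-1) * X.
  have -> : (2 / l2 + ln D / (lam * l2) + lam^-1) * X =
     (2 + ln D / lam) * (X / l2) + X / lam.
    by field; rewrite !gt_eqF.
  rewrite [_ / lam]mulrDl addrA lerD2r ler_peMr //.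
    by rewrite addr_ge0 // divr_ge0 // ltW.
  by rewrite ler_pdivlMr // mul1r.
apply: le_trans E.
have h0 : 0 <= (ln D + X) / lam by rewrite divr_ge0 ?addr_ge0 // ?ltW //; apply: lt_le_trans X2.
case: hk => [-> |hk]; first by lra.
case: k hk => [|k] /= hk; first by lra.
have : k%:R <= (ln D + X) / lam.
  rewrite ler_pdivlMr //.
  have : ln eta <= ln (phi ^+ k * D).
    by rewrite ler_ln ?posrE ?ltW // mulr_gt0 ?exprn_gt0 //; lra.
  rewrite lnM ?posrE ?exprn_gt0 ?lnXn //; try lra.
  by rewrite /X lnV ?posrE // /lam -mulr_natl; lra.
rewrite -!natr1; lra.
Qed.

(** * Perspective of the local worst-case value *)

Definition ball_growth {R : realType} {m : nat} (Z : set 'rV[R]_m) c (l : 'rV[R]_m -> R)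
    zh (G s : R) : Prop :=
  forall w u, Z (zh + w) -> c (zh + w) zh <= u -> 0 <= u ->
    l (zh + w) <= l zh + G * u `^ s.

Section local_value.
Context {R : realType} {m : nat}.
Local Notation V := 'rV[R]_m.
Variables (Z : set V) (c : V -> V -> R) (l : V -> R) (zh : V) (G tau sigma : R).
Hypothesis Z_conv : forall z z' (t : R), Z z -> Z z' -> 0 <= t <= 1 ->
  Z (t *: z + (1 - t) *: z').
Hypothesis l_concave : forall z z' (t : R), 0 <= t <= 1 ->
  t * l z + (1 - t) * l z' <= l (t *: z + (1 - t) *: z').
Hypothesis c_conv : forall z z' (t : R), Z z -> Z z' -> 0 <= t <= 1 ->
  c (t *: z + (1 - t) *: z') zh <= t * c z zh + (1 - t) * c z' zh.
Hypotheses (Z_zh : Z zh) (c_zh : c zh zh = 0) (G_ge0 : 0 <= G).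
Hypotheses (tau01 : 0 < tau <= 1) (sigma01 : 0 <= sigma < 1).
Hypothesis growth_tau : ball_growth Z c l zh G tau.
Hypothesis growth_sigma : ball_growth Z c l zh G sigma.

Definition ball_values (u : R) : set R :=
  [set l (zh + w) | w in [set w | Z (zh + w) /\ c (zh + w) zh <= u]].

Definition local_value (u : R) : R := sup (ball_values u).

Lemma ball_values_center u : 0 <= u -> ball_values u (l zh).
Proof. by move=> u0; exists 0; rewrite ?addr0 //= addr0 c_zh. Qed.

Lemma local_value_ge w u : 0 <= u -> Z (zh + w) -> c (zh + w) zh <= u ->
  l (zh + w) <= local_value u.
Proof.
move=> u0 hZ hc; apply: ub_le_sup; last by exists w.
by exists (l zh + G * u `^ tau) => _ [w' [Zw' cw'] <-]; apply: growth_tau.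
Qed.

Lemma local_value_le u M : 0 <= u ->
  (forall w, Z (zh + w) -> c (zh + w) zh <= u -> l (zh + w) <= M) ->
  local_value u <= M.
Proof.
move=> u0 h; apply: ge_sup; first by exists (l zh); exact: ball_values_center.
by move=> _ [w [Zw cw] <-]; apply: h.
Qed.

Lemma local_value_ge_center u : 0 <= u -> l zh <= local_value u.
Proof.
move=> u0; have := @local_value_ge 0 u u0; rewrite addr0 c_zh; exact.
Qed.

Lemma local_value_mono u v : 0 <= u -> u <= v -> local_value u <= local_value v.
Proof.
move=> u0 uv; apply: local_value_le => // w Zw cw.
by apply: local_value_ge => //; apply: le_trans uv.
Qed.

Lemma local_value_le_tau u : 0 <= u -> local_value u <= l zh + G * u `^ tau.
Proof. by move=> u0; apply: local_value_le => // w Zw cw; apply: growth_tau. Qed.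

Lemma local_value_le_sigma u : 0 <= u -> local_value u <= l zh + G * u `^ sigma.
Proof. by move=> u0; apply: local_value_le => // w Zw cw; apply: growth_sigma. Qed.

Lemma local_value_concave u v (t : R) : 0 <= u -> 0 <= v -> 0 <= t <= 1 ->
  t * local_value u + (1 - t) * local_value v <= local_value (t * u + (1 - t) * v).
Proof.
move=> u0 v0 /andP[t0 t1].
have [-> |tn0] := eqVneq t 0; first by rewrite !mul0r subr0 !mul1r !add0r.
have [-> |tn1] := eqVneq t 1; first by rewrite subrr !mul0r !mul1r !addr0.
have {}t0 : 0 < t by rewrite lt_def tn0.
have {}t1 : 0 < 1 - t by rewrite subr_gt0 lt_def eq_sym tn1.
suff h w w' : Z (zh + w) -> c (zh + w) zh <= u ->
    Z (zh + w') -> c (zh + w') zh <= v ->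
    t * l (zh + w) + (1 - t) * l (zh + w') <= local_value (t * u + (1 - t) * v).
  rewrite -lerBrDr -ler_pdivlMl //; apply: local_value_le => // w Zw cw.
  rewrite ler_pdivlMl // lerBrDr -lerBrDl -ler_pdivlMl //.
  apply: local_value_le => // w' Zw' cw'.
  by rewrite ler_pdivlMl // lerBrDl; apply: h.
move=> Zw cw Zw' cw'.
have t01 : 0 <= t <= 1 by lra.
have E : zh + (t *: w + (1 - t) *: w') = t *: (zh + w) + (1 - t) *: (zh + w').
  by rewrite !scalerDr addrACA -scalerDl [t + _]addrC subrK scale1r.
apply: (le_trans (l_concave _ _ t01)); rewrite -E; apply: local_value_ge.
- by rewrite addr_ge0 // mulr_ge0 // ltW.
- by rewrite E; apply: Z_conv.
- rewrite E; apply: (le_trans (c_conv Zw Zw' t01)).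
  by rewrite lerD // ler_pM2l.
Qed.

Lemma local_value_subadd u d : 0 <= u -> 0 <= d ->
  local_value (u + d) + l zh <= local_value u + local_value d.
Proof.
move=> u0 d0; have [E|E] := eqVneq (u + d) 0.
  have -> : d = 0 by lra.
  by rewrite addr0 lerD2l local_value_ge_center.
have ud : 0 < u + d by rewrite lt_def E addr_ge0.
have h00 := local_value_ge_center (lexx 0).
have h0 := addr_ge0 u0 d0.
have t1 : 0 <= u / (u + d) <= 1.
  by rewrite divr_ge0 //= ler_pdivrMr // mul1r; lra.
have t2 : 0 <= d / (u + d) <= 1.
  by rewrite divr_ge0 //= ler_pdivrMr // mul1r; lra.
have := local_value_concave h0 (lexx 0) t1; rewrite mulr0 addr0 divfK //.
have := local_value_concave h0 (lexx 0) t2; rewrite mulr0 addr0 divfK //.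
have -> : d / (u + d) = 1 - u / (u + d) by field.
lra.
Qed.

(* The perspective of [local_value]; its junk value 0 at [a = 0] is the
   contribution of a piece of weight 0. *)
Definition perspective (a b : R) : R := a * local_value (b / a).

Lemma perspective_superadd a b a' b' : 0 <= a -> 0 <= b -> 0 <= a' -> 0 <= b' ->
  perspective a b + perspective a' b' <= perspective (a + a') (b + b').
Proof.
rewrite /perspective => a0 b0 a'0 b'0.
have [-> |an] := eqVneq a 0.
  rewrite mul0r !add0r; apply: ler_wpM2l => //.
  by apply: local_value_mono; rewrite ?divr_ge0 // ler_wpM2r ?invr_ge0 // lerDr.
have [-> |a'n] := eqVneq a' 0.
  rewrite mul0r !addr0; apply: ler_wpM2l => //.
  by apply: local_value_mono; rewrite ?divr_ge0 // ler_wpM2r ?invr_ge0 // lerDl.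
have {}a0 : 0 < a by rewrite lt_def an.
have {}a'0 : 0 < a' by rewrite lt_def a'n.
have aa : 0 < a + a' by rewrite addr_gt0.
have t01 : 0 <= a / (a + a') <= 1.
  by rewrite divr_ge0 ?(ltW a0) ?(ltW aa) //= ler_pdivrMr // mul1r; lra.
have := local_value_concave (divr_ge0 b0 (ltW a0)) (divr_ge0 b'0 (ltW a'0)) t01.
have -> : a / (a + a') * (b / a) + (1 - a / (a + a')) * (b' / a') = (b + b') / (a + a').
  by field; rewrite !gt_eqF.
set X := local_value _; set Y := local_value _; set W := local_value _ => h.
have -> : a * X + a' * Y = (a + a') * (a / (a + a') * X + (1 - a / (a + a')) * Y).
  by field; rewrite !gt_eqF.
by rewrite ler_pM2l.
Qed.

Lemma perspective_homog t a b : 0 <= t ->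
  perspective (t * a) (t * b) = t * perspective a b.
Proof.
rewrite /perspective; have [-> |tn] := eqVneq t 0; first by rewrite !mul0r.
by move=> _; rewrite -mulf_div divff // mul1r mulrA.
Qed.

Lemma perspective_concave a b a' b' t :
  0 <= a -> 0 <= b -> 0 <= a' -> 0 <= b' -> 0 <= t <= 1 ->
  t * perspective a b + (1 - t) * perspective a' b' <=
  perspective (t * a + (1 - t) * a') (t * b + (1 - t) * b').
Proof.
move=> a0 b0 a'0 b'0 /andP[t0 t1].
have t1' : 0 <= 1 - t by rewrite subr_ge0.
by rewrite -!perspective_homog //; apply: perspective_superadd; rewrite mulr_ge0.
Qed.

Lemma perspective_mono a b b' : 0 <= a -> 0 <= b -> b <= b' ->
  perspective a b <= perspective a b'.
Proof.
move=> a0 b0 bb; rewrite ler_wpM2l // local_value_mono ?divr_ge0 //.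
by rewrite ler_wpM2r // invr_ge0.
Qed.

Lemma perspective_budget a b d : 0 < a -> a <= 1 -> 0 <= b -> 0 <= d ->
  perspective a (b + d) <= perspective a b + G * d `^ tau.
Proof.
move=> a0 a1 b0 d0; have a0' := ltW a0.
rewrite /perspective mulrDl.
have da : 0 <= d / a by rewrite divr_ge0.
have h1 := local_value_subadd (divr_ge0 b0 a0') da.
have h2 := local_value_le_tau da.
have h3 : a * (d / a) `^ tau <= d `^ tau.
  rewrite powRM ?invr_ge0 // mulrCA ler_piMr ?powR_ge0 //.
  rewrite -ler_pdivlMl // mulr1.
  have /andP[t0 t1] := tau01.
  rewrite -[leRHS]powRr1 ?invr_ge0 //; apply: ler_powR => //.
  by rewrite invf_ge1.
have h4 : a * (G * (d / a) `^ tau) <= G * d `^ tau by rewrite mulrCA ler_wpM2l.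
have := ler_wpM2l a0' h1; have := ler_wpM2l a0' h2.
rewrite !mulrDr; lra.
Qed.

Lemma perspective_weight_up a a' b : 0 <= a -> a <= a' -> 0 <= b ->
  perspective a b - (a' - a) * `|l zh| <= perspective a' b.
Proof.
move=> a0 aa b0; have d0 : 0 <= a' - a by rewrite subr_ge0.
have := perspective_superadd a0 b0 d0 (lexx 0).
rewrite addr0 [a + _]addrC subrK; apply: le_trans; rewrite lerD2l -mulrN.
rewrite /perspective mul0r ler_wpM2l //.
by apply: le_trans (local_value_ge_center (lexx 0)); rewrite lerNl ler_normr lexx orbT.
Qed.

Lemma perspective_weight_down a a' b B : 0 < a' -> a' <= a -> 0 <= b -> b <= B ->
  perspective a b <=
  perspective a' b + (a - a') * `|l zh| + G * B `^ sigma * (a - a') `^ (1 - sigma).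
Proof.
move=> a'0 aa b0 bB; have a0 : 0 < a by apply: lt_le_trans aa.
have B0 : 0 <= B by apply: le_trans bB.
have ba0 : 0 <= b / a by rewrite divr_ge0 // ltW.
have [-> |an] := eqVneq a a'.
  by rewrite subrr mul0r addr0 lerDl !mulr_ge0 // powR_ge0.
have d0 : 0 < a - a' by rewrite subr_gt0 lt_def an.
rewrite /perspective.
have h1 : local_value (b / a) <= local_value (b / a').
  apply: local_value_mono => //.
  by rewrite ler_wpM2l // lef_pV2.
have h2 := local_value_le_sigma ba0.
have /andP[s0 s1] := sigma01.
have h3 : (a - a') * (b / a) `^ sigma <= B `^ sigma * (a - a') `^ (1 - sigma).
  rewrite powRB; last by rewrite gt_eqF ?implybT.
  rewrite powRr1 ?(ltW d0) // mulrCA ler_pM2l //.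
  apply: (@le_trans _ _ ((B / (a - a')) `^ sigma)).
    apply: ge0_ler_powR; rewrite ?nnegrE ?divr_ge0 ?(ltW d0) ?(ltW a0) //.
    apply: ler_pM => //; first by rewrite invr_ge0 (ltW a0).
    by rewrite lef_pV2 // ?posrE //; lra.
  rewrite powRM ?invr_ge0 ?(ltW d0) //.
  by rewrite -[(a - a')^-1]powR_inv1 ?(ltW d0) // -powRrM mulN1r powRN.
have h4 := ler_norm (l zh).
have := ler_wpM2l (ltW a'0) h1.
have := ler_wpM2l (ltW d0) h2.
have := ler_wpM2l G_ge0 h3.
have := ler_wpM2l (ltW d0) h4.
rewrite !mulrDr !mulrA; set X := local_value (b / a); set Y := local_value _.
have -> : a * X = a' * X + (a - a') * X by ring.
rewrite [G * _]mulrC.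
lra.
Qed.

End local_value.

(** * Growth of concave losses *)

Section concave_growth.
Context {R : realType} {m : nat}.
Local Notation V := 'rV[R]_m.

Section concave_at_0.
Variable D : V -> R.
Hypothesis D0 : D 0 = 0.
Hypothesis D_concave : forall z z' (t : R), 0 <= t <= 1 ->
  t * D z + (1 - t) * D z' <= D (t *: z + (1 - t) *: z').

Lemma concave_ray e t : `|t| <= 1 -> - (`|D e| + `|D (- e)|) <= D (t *: e).
Proof.
have pos u s : 0 <= s <= 1 -> - `|D u| <= D (s *: u).
  move=> s01; have := D_concave u 0 s01; rewrite D0 scaler0 mulr0 !addr0.
  have := ler_norm (- D u); rewrite normrN; have := normr_ge0 (D u); nra.
move=> t1; have n1 := normr_ge0 (D e); have n2 := normr_ge0 (D (- e)).
have [t0|t0] := leP 0 t.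
  by rewrite ger0_norm // in t1; have := @pos e t; rewrite t0 t1 => /(_ isT); lra.
rewrite ltr0_norm // in t1; have := @pos (- e) (- t).
by rewrite scaleNr scalerN opprK t1 oppr_ge0 ltW // => /(_ isT); lra.
Qed.

(* Each coordinate is split off by a midpoint, which halves the radius [d]. *)
Lemma concave_lower_bound_span (s : seq 'I_m) : exists d M : R, 0 < d /\
  forall a : 'I_m -> R, (forall i, `|a i| <= d) ->
    - M <= D (\sum_(i <- s) a i *: delta_mx 0 i).
Proof.
elim: s => [|i s [d [M [d0 h]]]].
  by exists 1, 0; split=> // a _; rewrite big_nil D0 oppr0.
pose e : V := delta_mx 0 i.
exists (Num.min d 1 / 2), ((`|D e| + `|D (- e)| + M) / 2); split.
  by rewrite divr_gt0 // lt_min d0 ltr01.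
move=> a ha.
have ha2 j : `|2 * a j| <= Num.min d 1.
  by rewrite normrM ger0_norm // -ler_pdivlMl // mulrC.
have h1 : - (`|D e| + `|D (- e)|) <= D ((2 * a i) *: e).
  by apply: concave_ray; apply: le_trans (ha2 i) _; rewrite ge_min lexx orbT.
have h2 : - M <= D (\sum_(j <- s) (2 * a j) *: delta_mx 0 j).
  by apply: h => j; apply: le_trans (ha2 j) _; rewrite ge_min lexx.
have t01 : 0 <= (2^-1 : R) <= 1 by lra.
have := D_concave ((2 * a i) *: e) (\sum_(j <- s) (2 * a j) *: delta_mx 0 j) t01.
rewrite big_cons (_ : 1 - 2^-1 = 2^-1); last by lra.
have half j : 2^-1 * (2 * a j) = a j by lra.
rewrite scalerA half (_ : 2^-1 *: _ = \sum_(j <- s) a j *: delta_mx 0 j); last first.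
  by rewrite scaler_sumr; apply: eq_bigr => j _; rewrite scalerA half.
by rewrite -/e; lra.
Qed.

Lemma concave_lower_bound_ball : exists d M : R, [/\ 0 < d, 0 <= M &
  forall w, `|w| <= d -> - M <= D w].
Proof.
have [d [M [d0 h]]] := concave_lower_bound_span (index_enum 'I_m).
have hw w : `|w| <= d -> - M <= D w.
  move=> wd; rewrite [w]row_sum_delta; apply: h => i.
  apply: le_trans wd; rewrite [leRHS]/Num.norm /= mx_normrE.
  exact: (le_bigmax _ (fun ij => `|w ij.1 ij.2|) (0, i)).
exists d, M; split=> //.
by have := hw 0; rewrite normr0 D0 ltW // => /(_ isT); lra.
Qed.

Lemma concave_linear_growth : exists2 G : R, 0 <= G & forall v, D v <= G * `|v|.
Proof.
have [d [M [d0 M0 h]]] := concave_lower_bound_ball.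
exists (M / d) => [|v]; first by rewrite divr_ge0 // ltW.
have [-> |vn] := eqVneq v 0; first by rewrite D0 normr0 mulr0.
have v0 : 0 < `|v| by rewrite normr_gt0.
pose t := d / `|v|; have t0 : 0 < t by rewrite divr_gt0.
have hM : - M <= D (- t *: v).
  by apply: h; rewrite normrZ normrN gtr0_norm // divfK // gt_eqF.
pose a := t / (1 + t).
have a01 : 0 <= a <= 1.
  by rewrite divr_ge0 ?addr_ge0 ?(ltW t0) //= ler_pdivrMr; lra.
have := D_concave v (- t *: v) a01.
rewrite scalerA -scalerDl (_ : a + (1 - a) * - t = 0); last first.
  by rewrite /a; field; rewrite gt_eqF //; lra.
rewrite scale0r D0 => h0.
have e1 : 1 - a = (1 + t)^-1 by rewrite /a; field; rewrite gt_eqF //; lra.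
rewrite e1 in h0.
have t1 : 0 < (1 + t)^-1 by rewrite invr_gt0; lra.
have h2 : (1 + t)^-1 * (t * D v + D (- t *: v)) <= 0.
  by rewrite mulrDr mulrA [_ * t]mulrC.
have h3 : t * D v <= M by move: h2; rewrite pmulr_rle0 //; lra.
have -> : M / d * `|v| = t^-1 * M by rewrite /t; field; rewrite !gt_eqF.
by rewrite ler_pdivlMl.
Qed.

End concave_at_0.

Lemma is_norm_lower_bound (nrm : V -> R) : is_norm nrm ->
  exists2 k : R, 0 <= k & forall v, `|v| <= k * nrm v.
Proof.
move=> [nD nZ n0].
have nrm0 : nrm 0 = 0 by rewrite -(scale0r (0 : V)) nZ normr0 mul0r.
have nN v : nrm (- v) = nrm v by rewrite -scaleN1r nZ normrN normr1 mul1r.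
have nge0 v : 0 <= nrm v.
  by have := nD v (- v); rewrite subrr nrm0 nN; lra.
pose K : R := \sum_(i < m) nrm (delta_mx 0 i).
have nK v : nrm v <= K * `|v|.
  rewrite [v in nrm v]row_sum_delta /K mulr_suml.
  elim/big_rec2: _ => [|i y1 y2 _ h]; first by rewrite nrm0.
  apply: le_trans (nD _ _) _; apply: lerD => //; rewrite nZ mulrC ler_wpM2l //.
  rewrite [leRHS]/Num.norm /= mx_normrE.
  exact: (le_bigmax _ (fun ij => `|v ij.1 ij.2|) (0, i)).
have ncont : continuous nrm.
  move=> v; apply/(@cvgrPdist_le _ _ _ (nbhs v)) => e e0.
  have K0 : 0 < K + 1 by rewrite ltr_wpDl // sumr_ge0.
  apply/nbhs_ballP; exists (e / (K + 1)) => [|w]; first exact: divr_gt0.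
  rewrite -ball_normE => /= /ltW hw.
  have h1 := nD (v - w) w; have h2 := nD (w - v) v.
  rewrite !subrK -[w - v]opprB nN in h1 h2.
  have h3 := nK (v - w).
  have h4 : K * `|v - w| <= e.
    apply: (@le_trans _ _ ((K + 1) * (e / (K + 1)))); last first.
      by rewrite mulrC divfK // gt_eqF.
    apply: ler_pM => //; [by rewrite sumr_ge0|lra].
  by rewrite ler_norml; lra.
pose S : set V := [set v | `|v| = 1].
have [[v1 Sv1]|Sn] := pselect (S !=set0); last first.
  exists 0 => // v; rewrite mul0r; have [-> |vn] := eqVneq v 0; first by rewrite normr0.
  exfalso; apply: Sn; exists (`|v|^-1 *: v); rewrite /S /= normrZ normfV normr_id mulVf //.
  by rewrite normr_eq0.
have Sc : compact S.
  apply: bounded_closed_compact.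
    by exists 1; split=> // x x1 v /= ->; exact: ltW.
  have -> : S = (fun v : V => `|v|) @^-1` [set 1] by [].
  apply: preimage_closed; last exact: closed_eq.
  by move=> v _; exact: (@norm_continuous _ ('rV[R]_m : normedModType R)).
have [||u Su hu] := @EVT_min_rV R m nrm S _ Sc; first by exists v1.
  exact: continuous_subspaceT.
rewrite inE in Su.
have u0 : 0 < nrm u.
  rewrite lt_def nge0 andbT; apply/eqP => /n0 E.
  by move: Su; rewrite /S /= E normr0 => /esym/eqP; rewrite oner_eq0.
exists (nrm u)^-1 => [|v]; first by rewrite invr_ge0.
have [-> |vn] := eqVneq v 0; first by rewrite normr0 nrm0 mulr0.
have v0 : 0 < `|v| by rewrite normr_gt0.
have h : nrm u <= `|v|^-1 * nrm v.
  have := hu (`|v|^-1 *: v); rewrite nZ normfV normr_id; apply.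
  by rewrite inE /S /= normrZ normfV normr_id mulVf // gt_eqF.
by rewrite ler_pdivlMl // in h; rewrite ler_pdivlMl // mulrC.
Qed.

Lemma concave_growth (nrm : V -> R) (l : V -> R) (z : V) : is_norm nrm ->
  (forall z z' (t : R), 0 <= t <= 1 ->
    t * l z + (1 - t) * l z' <= l (t *: z + (1 - t) *: z')) ->
  exists2 G : R, 0 <= G & forall v, l (z + v) <= l z + G * nrm v.
Proof.
move=> hn lc.
have [||G G0 hG] := @concave_linear_growth (fun v => l (z + v) - l z).
- by rewrite addr0 subrr.
- move=> u v t t01 /=; have := lc (z + u) (z + v) t t01.
  have -> : t *: (z + u) + (1 - t) *: (z + v) = z + (t *: u + (1 - t) *: v).
    by rewrite !scalerDr addrACA -scalerDl [t + _]addrC subrK scale1r.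
  lra.
have [k k0 hk] := is_norm_lower_bound hn.
exists (G * k) => [|v]; first by rewrite mulr_ge0.
have := hG v; have := ler_wpM2l G0 (hk v); rewrite mulrA; lra.
Qed.

End concave_growth.

Lemma convex_setE {R : realType} {m : nat} (Z : set 'rV[R]_m) z z' (t : R) :
  convex_set Z -> Z z -> Z z' -> 0 <= t <= 1 -> Z (t *: z + (1 - t) *: z').
Proof.
move=> hZ Zz Zz' /andP[t0 t1].
have := hZ z z' (Itv01 t0 t1); rewrite !inE; exact.
Qed.

Lemma convex_functionE {R : realType} {m : nat} (Z : set 'rV[R]_m) (f : 'rV[R]_m -> R)
    z z' (t : R) :
  convex_function Z f -> Z z -> Z z' -> 0 <= t <= 1 ->
  f (t *: z + (1 - t) *: z') <= t * f z + (1 - t) * f z'.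
Proof.
move=> hf Zz Zz' /andP[t0 t1].
have := hf (Itv01 t0 t1) z z'; rewrite !inE; exact.
Qed.

Lemma powR_le_root {R : realType} (p a u : R) : 1 <= p -> 0 <= a -> a `^ p <= u ->
  a <= u `^ p^-1.
Proof.
move=> p1 a0 h; have p0 : 0 < p by apply: lt_le_trans p1.
have u0 : 0 <= u by apply: le_trans h; exact: powR_ge0.
have -> : a = (a `^ p) `^ p^-1 by rewrite -powRrM mulfV ?powRr1 // gt_eqF.
by apply: ge0_ler_powR; rewrite ?nnegrE ?invr_ge0 ?powR_ge0 // ltW.
Qed.

Lemma powR_shift_le {R : realType} (r a d u : R) : 0 <= r -> 0 <= d -> 0 <= a ->
  1 <= u -> a <= u + d -> a `^ r <= (1 + d) `^ r * u `^ r.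
Proof.
move=> r0 d0 a0 u1 au; rewrite -powRM ?addr_ge0 //; last by lra.
by apply: ge0_ler_powR; rewrite ?nnegrE //; nra.
Qed.

Lemma powR_le_min {R : realType} (d eta B theta s : R) :
  0 <= d -> d <= eta -> d <= B -> 0 < theta -> theta <= s -> s <= 1 ->
  d `^ s <= (1 + B) * eta `^ theta.
Proof.
move=> d0 de dB t0 ts s1.
have B0 : 0 <= B by apply: le_trans dB.
have [->|dn] := eqVneq d 0.
  by rewrite powR0 ?mulr_ge0 ?powR_ge0 ?addr_ge0 // gt_eqF //; apply: lt_le_trans ts.
have -> : s = (s - theta) + theta by rewrite subrK.
rewrite powRD ?dn ?implybT //; apply: ler_pM; rewrite ?powR_ge0 //.
  apply: (@le_trans _ _ ((1 + B) `^ (s - theta))).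
    by apply: ge0_ler_powR; rewrite ?nnegrE ?subr_ge0 //; lra.
  apply: (@le_trans _ _ ((1 + B) `^ 1)); last by rewrite powRr1 // addr_ge0.
  by apply: ler_powR; lra.
by apply: ge0_ler_powR; rewrite ?nnegrE ?(ltW t0) //; lra.
Qed.

Section exponents.
Context {R : realType} {n m K N : nat}.
Variables (X : set 'rV[R]_n) (Z : set 'rV[R]_m) (c : 'rV[R]_m -> 'rV[R]_m -> R).
Variable ell : 'I_K -> 'rV[R]_n -> 'rV[R]_m -> R.
Variables (zhat : 'I_N -> 'rV[R]_m) (rho : R) (nrm : 'rV[R]_m -> R) (p : R).
Hypothesis hreg : regularity_assumption X Z c ell zhat rho nrm p.
Variables (x : 'rV[R]_n) (zh : 'rV[R]_m).
Hypothesis Z_zh : Z zh.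

Lemma reg_concave k z z' (t : R) : 0 <= t <= 1 ->
  t * ell k x z + (1 - t) * ell k x z' <= ell k x (t *: z + (1 - t) *: z').
Proof.
move=> t01; have := convex_functionE (reg_ell_concave hreg k x) (z := z) (z' := z') I I t01.
lra.
Qed.

Lemma growth_exponents theta : error_exponent Z ell nrm p x theta ->
  exists tau sigma : R,
    [/\ 0 < tau <= 1, 0 <= sigma < 1, 0 < theta, theta <= tau & theta <= 1 - sigma] /\
    forall k, exists2 G : R, 0 <= G &
      ball_growth Z c (ell k x) zh G tau /\ ball_growth Z c (ell k x) zh G sigma.
Proof.
have p1 := reg_p hreg.
have [nD nZ n0] := reg_norm hreg.
have nN v : nrm (- v) = nrm v by rewrite -scaleN1r nZ normrN normr1 mul1r.
have nge0 v : 0 <= nrm v.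
  by have := nD v (- v); rewrite subrr -(scale0r (0 : 'rV[R]_m)) nZ normr0 mul0r nN; lra.
have G1 k : exists2 G : R, 0 <= G & ball_growth Z c (ell k x) zh G p^-1.
  have [G G0 hG] := concave_growth zh (reg_norm hreg) (reg_concave k).
  exists G => // w u Zw cw u0; apply: le_trans (hG w) _.
  rewrite lerD2l ler_wpM2l //; apply: powR_le_root => //; apply: le_trans cw.
  by have := reg_cost_lb hreg Zw Z_zh; rewrite addrAC subrr add0r.
case=> [[p1' ->]|[pE [g [z0 [r [[g0 Zz0 /andP[r0 r1] hg] ->]]]]]].
  have pV0 : 0 < p^-1 by rewrite invr_gt0; lra.
  have pV1 : p^-1 < 1 by rewrite invf_lt1; lra.
  exists p^-1, p^-1; split.
    by split; rewrite ?lt_min ?ge_min ?lexx ?orbT //; lra.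
  by move=> k; have [G G0 hG] := G1 k; exists G.
exists 1, r; split; first by split; lra.
move=> k; have [G G0 hG] := G1 k; rewrite pE invr1 in hG.
pose d := nrm (zh - z0).
pose G' := G + (g + g * (1 + d) `^ r + `|ell k x zh|).
have GG' : G <= G' by rewrite lerDl !addr_ge0 ?mulr_ge0 ?powR_ge0 // ltW.
exists G'; first exact: le_trans GG'.
split=> w u Zw cw u0.
  apply: le_trans (hG w u Zw cw u0) _; rewrite lerD2l ler_wpM2r ?powR_ge0 //.
have [u1|u1] := leP u 1.
  apply: le_trans (hG w u Zw cw u0) _; rewrite lerD2l ler_pM ?powR_ge0 //.
  rewrite powRr1 //; have [->|un] := eqVneq u 0; first exact: powR_ge0.
  by apply: ger1_powR; rewrite ?(ltW r1) // lt_def un u0.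
have hl : ell k x (zh + w) <= g * (1 + nrm (zh + w - z0) `^ r).
  by rewrite -lee_fin; apply: le_trans (hg _ Zw); apply: (le_bigmax _ _ k).
have nu : nrm (zh + w - z0) <= u + d.
  rewrite addrAC addrC; apply: le_trans (nD _ _) _; rewrite lerD2r.
  apply: le_trans cw; have := reg_cost_lb hreg Zw Z_zh.
  by rewrite addrAC subrr add0r pE powRr1.
have hr := powR_shift_le r0 (nge0 _) (nge0 _) (ltW u1) nu; rewrite -/d in hr.
have ur : 1 <= u `^ r by rewrite -[leLHS](powRr0 u); apply: ler_powR => //; exact: ltW.
have := ler_wpM2l (ltW g0) hr.
have h5 := ler_norm (- ell k x zh); rewrite normrN in h5.
have h6 := normr_ge0 (ell k x zh).
have : 0 <= G * u `^ r by rewrite mulr_ge0 // powR_ge0.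
rewrite /G' !mulrDl mulrA; rewrite mulrDr mulr1 in hl.
have := ler_wpM2l (ltW g0) ur; have := ler_wpM2l h6 ur.
lra.
Qed.

End exponents.

(** * The two nested searches *)

Section pair.
Context {R : realType} {m K : nat}.
Local Notation V := 'rV[R]_m.
Variables (Z : set V) (c : V -> V -> R) (l : 'I_K -> V -> R) (zh : V) (k1 k2 : 'I_K) (B : R).
Hypothesis Z_conv : forall z z' (t : R), Z z -> Z z' -> 0 <= t <= 1 ->
  Z (t *: z + (1 - t) *: z').
Hypothesis l_concave : forall k z z' (t : R), 0 <= t <= 1 ->
  t * l k z + (1 - t) * l k z' <= l k (t *: z + (1 - t) *: z').
Hypothesis c_conv : forall z z' (t : R), Z z -> Z z' -> 0 <= t <= 1 ->
  c (t *: z + (1 - t) *: z') zh <= t * c z zh + (1 - t) * c z' zh.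
Hypotheses (Z_zh : Z zh) (c_zh : c zh zh = 0) (B_ge0 : 0 <= B).
Variables (wco : 'I_K -> R -> V -> R -> R * V) (cost : 'I_K -> R -> nat) (eps eta : R).
Hypothesis oracle : wc_oracle Z c l wco cost.
Hypotheses (eps_gt0 : 0 < eps) (eta_gt0 : 0 < eta).
Local Notation feasible := (pair_feasible Z c zh B).
Local Notation objective := (pair_objective (l k1) (l k2) zh).
Local Notation ieval := (inner_eval wco cost eps zh k1 k2 B).
Local Notation isolve := (inner_solver wco cost eps eta zh k1 k2 B).
Local Notation peval := (pair_eval wco cost eps eta zh k1 k2 B).

Definition certified (o : R * local_solution R m) : Prop :=
  feasible o.2 /\ o.1 = objective o.2.

Lemma inner_eval_certified a b o t : 0 < a < 1 -> 0 <= b <= B -> ieval a b o t ->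
  certified o.
Proof.
move=> /andP[a0 a1] /andP[b0 bB]; rewrite /inner_eval.
have a20 : 0 < 1 - a by rewrite subr_gt0.
have b1 : 0 <= b / a by rewrite divr_ge0 // ltW.
have b2 : 0 <= (B - b) / (1 - a) by rewrite divr_ge0 ?(ltW a20) ?subr_ge0.
have [_ /(_ _ _ Z_zh b1)] := oracle k1 eps_gt0.
have [_ /(_ _ _ Z_zh b2)] := oracle k2 eps_gt0.
case: (wco _ _ _ (b / a)) => [L1 v1]; case: (wco _ _ _ _) => [L2 v2].
move=> [Zv2 cv2 -> _] [Zv1 cv1 -> _] [-> _]; split=> //=; split=> //.
- by split; rewrite ?subr_ge0 // ltW.
- by split; rewrite mulrC -ler_pdivlMr.
- by rewrite addrC subrK.
- by rewrite addrC subrK.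
Qed.

Lemma inside01 (a : R) : inside 0 1 a -> 0 < a < 1.
Proof. by case=> _; apply; exact: ltr01. Qed.

Lemma inner_solver_certified a o t : inside 0 1 a -> isolve a o t -> certified o.
Proof.
move=> /inside01 a01 [t0 /(golden_section_attained B_ge0) [b [t1 [[b0 _] e]]] _].
exact: inner_eval_certified e.
Qed.

Lemma pair_eval_certified o t : peval o t -> certified o.
Proof.
by move=> /(golden_section_attained ler01) [a [t1 [ha]]]; apply: inner_solver_certified.
Qed.

Lemma pair_eval_total : exists o t, peval o t.
Proof.
apply: golden_section_total => // a.
have [| o [t h]] := golden_section_total eta_gt0 B_ge0 (ev := ieval a).
  move=> b; rewrite /inner_eval.
  case: (wco _ _ _ (b / a)) => [L1 v1]; case: (wco _ _ _ _) => [L2 v2].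
  by eexists; eexists.
by exists o, (1 + t)%N, t.
Qed.

Lemma inner_eval_det a b o o' t t' : ieval a b o t -> ieval a b o' t' -> o = o'.
Proof.
rewrite /inner_eval.
case: (wco _ _ _ (b / a)) => [L1 v1]; case: (wco _ _ _ _) => [L2 v2].
by move=> [-> _] [-> _].
Qed.

Lemma inner_solver_det a o o' t t' : isolve a o t -> isolve a o' t' -> o.1 = o'.1.
Proof.
move=> [t0 h _] [t0' h' _].
exact: (golden_section_det (@inner_eval_det a) h h').
Qed.

Section precision.
Variables G tau sigma theta : R.
Hypotheses (G_ge0 : 0 <= G) (tau01 : 0 < tau <= 1) (sigma01 : 0 <= sigma < 1).
Hypotheses (theta_gt0 : 0 < theta) (theta_tau : theta <= tau)
  (theta_sigma : theta <= 1 - sigma).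
Hypothesis growth_tau : forall k, k = k1 \/ k = k2 -> ball_growth Z c (l k) zh G tau.
Hypothesis growth_sigma : forall k, k = k1 \/ k = k2 -> ball_growth Z c (l k) zh G sigma.

Definition pair_value (a b : R) : R :=
  perspective Z c (l k1) zh a b + perspective Z c (l k2) zh (1 - a) (B - b).

Let gt1 := growth_tau (or_introl erefl).
Let gt2 := growth_tau (or_intror erefl).
Let gs1 := growth_sigma (or_introl erefl).
Let gs2 := growth_sigma (or_intror erefl).

Lemma pair_value_concave a b a' b' t :
  0 <= a <= 1 -> 0 <= b <= B -> 0 <= a' <= 1 -> 0 <= b' <= B -> 0 <= t <= 1 ->
  t * pair_value a b + (1 - t) * pair_value a' b' <=
  pair_value (t * a + (1 - t) * a') (t * b + (1 - t) * b').
Proof.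
move=> /andP[a0 a1] /andP[b0 b1] /andP[a'0 a'1] /andP[b'0 b'1] t01.
have h1 := perspective_concave Z_conv (l_concave k1) c_conv Z_zh c_zh gt1 a0 b0 a'0 b'0 t01.
have h2 := perspective_concave Z_conv (l_concave k2) c_conv Z_zh c_zh gt2.
have {}h2 := h2 (1 - a) (B - b) (1 - a') (B - b') t.
rewrite !subr_ge0 in h2; have {}h2 := h2 a1 b1 a'1 b'1 t01.
rewrite /pair_value.
have -> : 1 - (t * a + (1 - t) * a') = t * (1 - a) + (1 - t) * (1 - a') by ring.
have -> : B - (t * b + (1 - t) * b') = t * (B - b) + (1 - t) * (B - b') by ring.
lra.
Qed.

Lemma objective_le_pair_value s : feasible s ->
  [/\ 0 <= ls_alpha1 s <= 1, 0 <= ls_beta1 s <= B &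
    objective s <= pair_value (ls_alpha1 s) (ls_beta1 s)].
Proof.
case: s => a1 a2 b1 b2 v1 v2 /= [[a10 a20 b10 b20] [Z1 Z2] [c1 c2] ha hb].
have a1E : 1 - a1 = a2 by lra.
have b1E : B - b1 = b2 by lra.
split; [lra|lra|rewrite /pair_objective /pair_value /= a1E b1E].
have le k a b v : k = k1 \/ k = k2 -> 0 <= a -> 0 <= b -> Z (zh + v) ->
    a * c (zh + v) zh <= b -> a * l k (zh + v) <= perspective Z c (l k) zh a b.
  move=> hk a0 b0 Zv cv; rewrite /perspective.
  have [->|an] := eqVneq a 0; first by rewrite !mul0r.
  rewrite ler_wpM2l //; apply: (local_value_ge (growth_tau hk)) => //.
    by rewrite divr_ge0.
  by rewrite ler_pdivlMr 1?mulrC // lt_def an.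
by apply: lerD; apply: le => //; [left|right].
Qed.

Lemma inner_eval_value a b o t : 0 < a < 1 -> 0 <= b <= B -> ieval a b o t ->
  o.1 <= pair_value a b <= o.1 + eps.
Proof.
move=> a01 b01 e; have [fe ->] := inner_eval_certified a01 b01 e.
have [_ _ le] := objective_le_pair_value fe.
move: a01 b01 => /andP[a0 a1] /andP[b0 bB].
have a20 : 0 < 1 - a by rewrite subr_gt0.
have b1 : 0 <= b / a by rewrite divr_ge0 // ltW.
have b2 : 0 <= (B - b) / (1 - a) by rewrite divr_ge0 ?(ltW a20) ?subr_ge0.
move: e le; rewrite /inner_eval.
have [_ /(_ _ _ Z_zh b1)] := oracle k1 eps_gt0.
have [_ /(_ _ _ Z_zh b2)] := oracle k2 eps_gt0.
case: (wco _ _ _ (b / a)) => [L1 v1]; case: (wco _ _ _ _) => [L2 v2].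
move=> [_ _ E2 h2] [_ _ E1 h1] [-> _] /= le; rewrite le /=.
rewrite /pair_objective /= -E1 -E2 /pair_value /perspective.
have := ler_wpM2l (ltW a0) h1; have := ler_wpM2l (ltW a20) h2.
rewrite -/(ball_values _ _ _ _ _) -/(local_value _ _ _ _ _).
rewrite -/(ball_values _ _ _ _ _) -/(local_value _ _ _ _ _).
lra.
Qed.

Lemma pair_value_budget a b b' : 0 < a < 1 -> 0 <= b <= B -> 0 <= b' <= B ->
  pair_value a b <= pair_value a b' + G * `|b - b'| `^ tau.
Proof.
move=> /andP[a0 a1] /andP[b0 bB] /andP[b'0 b'B]; rewrite /pair_value.
have a20 : 0 < 1 - a by rewrite subr_gt0.
have [bb|/ltW bb] := leP b' b.
  rewrite ger0_norm ?subr_ge0 //.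
  have := perspective_budget Z_conv (l_concave k1) c_conv Z_zh c_zh G_ge0 tau01 gt1
    a0 (ltW a1) b'0 (d := b - b').
  rewrite subr_ge0 addrC subrK => /(_ bb).
  have := @perspective_mono _ _ _ _ _ _ _ _ Z_zh c_zh gt2 (1 - a) (B - b) (B - b').
  rewrite (ltW a20) subr_ge0 bB => /(_ isT isT); lra.
rewrite ler0_norm ?subr_le0 // opprB.
have := perspective_budget Z_conv (l_concave k2) c_conv Z_zh c_zh G_ge0 tau01 gt2
  a20 _ _ (b := B - b') (d := b' - b).
rewrite !subr_ge0 (_ : B - b' + (b' - b) = B - b); last by ring.
rewrite lerBlDr lerDl (ltW a0) => /(_ isT b'B bb).
have := @perspective_mono _ _ _ _ _ _ _ _ Z_zh c_zh gt1 a b b' (ltW a0) b0 bb; lra.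
Qed.

Lemma pair_value_weight a a' b : 0 <= a <= 1 -> 0 < a' < 1 -> 0 <= b <= B ->
  pair_value a b <= pair_value a' b + `|a - a'| * (`|l k1 zh| + `|l k2 zh|) +
    G * B `^ sigma * `|a - a'| `^ (1 - sigma).
Proof.
move=> /andP[a0 a1] /andP[a'0 a'1] /andP[b0 bB]; rewrite /pair_value.
have b20 : 0 <= B - b by rewrite subr_ge0.
have b2B : B - b <= B by rewrite lerBlDr lerDl.
have [aa|/ltW aa] := leP a' a.
  rewrite ger0_norm ?subr_ge0 //.
  have := perspective_weight_down Z_zh c_zh G_ge0 sigma01 gt1 gs1 a'0 aa b0 bB.
  have := @perspective_weight_up _ _ _ _ _ _ _ _ Z_conv (l_concave k2) c_conv
    Z_zh c_zh gt2 (1 - a) (1 - a') (B - b).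
  rewrite subr_ge0 a1 lerD2l lerN2 aa b20 => /(_ isT isT isT).
  have -> : 1 - a' - (1 - a) = a - a' by ring.
  lra.
rewrite ler0_norm ?subr_le0 // opprB.
have := perspective_weight_down Z_zh c_zh G_ge0 sigma01 gt2 gs2
  (a := 1 - a) (a' := 1 - a') _ _ b20 b2B.
rewrite subr_gt0 a'1 lerD2l lerN2 aa => /(_ isT isT).
have := @perspective_weight_up _ _ _ _ _ _ _ _ Z_conv (l_concave k1) c_conv
  Z_zh c_zh gt1 a a' b a0 aa b0.
have -> : 1 - a - (1 - a') = a' - a by ring.
lra.
Qed.

Definition inner_precision : R := 4 * eps + G * (1 + B) * eta `^ theta.

Lemma inner_solver_value a o t : inside 0 1 a -> isolve a o t ->
  (exists2 b, 0 <= b <= B & o.1 <= pair_value a b) /\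
  forall b, 0 <= b <= B -> pair_value a b <= o.1 + inner_precision.
Proof.
move=> /inside01 a01 hs; have := hs => -[t0 gs _]; split.
  have [b [t1 [[b0 _] e]]] := golden_section_attained B_ge0 gs.
  by exists b => //; have /andP[] := inner_eval_value a01 b0 e.
move=> b b01.
have a01' : 0 <= a <= 1 by case/andP: a01 => /ltW -> /ltW ->.
pose H y v := 0 <= y <= B /\ v <= pair_value a y.
have Hconv y v y' v' (s : R) : H y v -> H y' v' -> 0 <= s <= 1 ->
    H (s * y + (1 - s) * y') (s * v + (1 - s) * v').
  move=> [y01 hv] [y01' hv'] s01; split; first by nra.
  have := pair_value_concave a01' y01 a01' y01' s01.
  have -> : s * a + (1 - s) * a = a by ring.
  by apply: le_trans; apply: lerD; apply: ler_wpM2l => //; lra.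
have ehypo y o' t' : inside 0 B y -> ieval a y o' t' ->
    H y o'.1 /\ forall v, H y v -> v <= o'.1 + eps.
  move=> [y01 _] e; have /andP[h1 h2] := inner_eval_value a01 y01 e.
  by split=> // v [_ hv]; apply: le_trans h2.
have edet y o' o2 t' t2 : ieval a y o' t' -> ieval a y o2 t2 -> o'.1 = o2.1.
  by move=> e1 e2; rewrite (inner_eval_det e1 e2).
have hb : H b (pair_value a b) by [].
have pe : 0 <= G * (1 + B) * eta `^ theta.
  by rewrite !mulr_ge0 ?powR_ge0 ?addr_ge0.
have [|[y [ o' [t' [[y01 _] xy e oo]]]]] :=
    golden_section_error eta_gt0 B_ge0 Hconv edet ehypo (ltW eps_gt0) gs b01 hb.
  by have := ltW eps_gt0; rewrite /inner_precision; lra.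
have /andP[_ h2] := inner_eval_value a01 y01 e.
have h3 := pair_value_budget a01 b01 y01.
have h4 : `|b - y| `^ tau <= (1 + B) * eta `^ theta.
  apply: powR_le_min => //; last by case/andP: tau01.
  by rewrite ler_norml; lra.
have := ler_wpM2l G_ge0 h4; rewrite /inner_precision mulrA.
by have := ltW eps_gt0; lra.
Qed.

Lemma pair_eval_precision o t s : peval o t -> feasible s ->
  objective s <= o.1 + 4 * inner_precision +
    (2 * (`|l k1 zh| + `|l k2 zh|) + G * B `^ sigma * 2) * eta `^ theta.
Proof.
move=> ho /objective_le_pair_value [a01 b01]; set a := ls_alpha1 s in a01 *.
set b := ls_beta1 s in b01 * => le; apply: (le_trans le).
pose H y v := 0 <= y <= 1 /\ exists2 b, 0 <= b <= B & v <= pair_value y b.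
have Hconv y v y' v' (r : R) : H y v -> H y' v' -> 0 <= r <= 1 ->
    H (r * y + (1 - r) * y') (r * v + (1 - r) * v').
  move=> [y01 [bv bv01 hv]] [y01' [bv' bv01' hv']] r01; split; first by nra.
  exists (r * bv + (1 - r) * bv'); first by nra.
  have := pair_value_concave y01 bv01 y01' bv01' r01.
  by apply: le_trans; apply: lerD; apply: ler_wpM2l => //; lra.
have ehypo y o' t' : inside 0 1 y -> isolve y o' t' ->
    H y o'.1 /\ forall v, H y v -> v <= o'.1 + inner_precision.
  move=> yi e; have [h1 h2] := inner_solver_value yi e.
  split; first by split=> //; case: yi.
  by move=> v [_ [bv bv01 hv]]; apply: le_trans (h2 _ bv01).
have hs : H a (pair_value a b) by split=> //; exists b.
have P0 : 0 <= inner_precision.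
  by rewrite addr_ge0 ?mulr_ge0 ?powR_ge0 ?addr_ge0 // ltW.
have D0 : 0 <= (2 * (`|l k1 zh| + `|l k2 zh|) + G * B `^ sigma * 2) * eta `^ theta.
  by rewrite !(mulr_ge0, addr_ge0) // ?powR_ge0.
have [|[y [ o' [t' [yi xy e oo]]]]] :=
    golden_section_error eta_gt0 ler01 Hconv inner_solver_det ehypo P0 ho a01 hs.
  by lra.
have [_ h2] := inner_solver_value yi e.
have h3 := pair_value_weight a01 (inside01 yi) b01.
have [y01 _] := yi.
have d1 : `|a - y| <= 1 by rewrite ler_norml; lra.
have /andP[s0 s1] := sigma01.
have h4 : `|a - y| `^ (1 - sigma) <= (1 + 1) * eta `^ theta.
  by apply: powR_le_min => //; lra.
have h5 : `|a - y| `^ 1 <= (1 + 1) * eta `^ theta.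
  by apply: powR_le_min => //; apply: (le_trans theta_sigma); lra.
rewrite powRr1 // in h5.
have n0 : 0 <= `|l k1 zh| + `|l k2 zh| by rewrite addr_ge0.
have GB : 0 <= G * B `^ sigma by rewrite mulr_ge0 ?powR_ge0.
have := ler_wpM2l n0 h5; have := ler_wpM2l GB h4; have := h2 _ b01.
lra.
Qed.

End precision.

End pair.

Lemma pair_eval_time (R : realType) (m K : nat) (k1 k2 : 'I_K) (B : R) : 0 <= B ->
  exists2 C : R, 0 < C &
    forall (wco : 'I_K -> R -> 'rV[R]_m -> R -> R * 'rV[R]_m) cost eps eta zh o t,
      (0 < cost k1 eps)%N -> 0 < eta -> eta <= 2^-1 ->
      pair_eval wco cost eps eta zh k1 k2 B o t ->
      t%:R <= C * ((cost k1 eps + cost k2 eps)%:R * (ln eta^-1) ^+ 2).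
Proof.
move=> B0; have D1 : 1 <= 1 + B by rewrite lerDl.
have [C C0 hC] := golden_passes_bound D1.
exists (57 * C ^+ 2) => [|wco cost eps eta zh o t c0 eta0 eta2 h].
  by rewrite mulr_gt0 // exprn_gt0.
set n := (_ + _)%N; set M := C * ln eta^-1.
have n1 : 1 <= n%:R :> R by rewrite ler1n /n addn_gt0 c0.
have passes k d : d <= 1 + B -> (k = 0%N \/ eta < golden_ratio ^+ k.-1 * d) ->
    k.+1%:R <= M.
  move=> dB hk; apply: hC => //; case: hk => [|hk]; [by left|right].
  apply: lt_le_trans hk _; rewrite ler_wpM2l // exprn_ge0 //.
  by have /andP[] := @golden_ratio_bounds R; lra.
have M1 : 1 <= M by apply: (passes 0%N 1); [lra|left].
have M0 : 0 <= M by apply: le_trans M1.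
have inner a o' t' : inner_solver wco cost eps eta zh k1 k2 B a o' t' ->
    t'%:R <= 24 * (M * n%:R).
  move=> [t0 gs ->].
  have [||k [tk hk]] := @golden_section_time _ _ _ eta 0 B B0 (n%:R + 6) _ _ gs.
  - by lra.
  - move=> b o'' t'' _; rewrite /inner_eval.
    case: (wco _ _ _ (b / a)) => [L1 v1]; case: (wco _ _ _ _) => [L2 v2].
    by move=> [_ ->]; rewrite natrD.
  have kM : k.+1%:R <= M by apply: (passes k (B - 0)) => //; lra.
  rewrite natrD; have := ler_wpM2r (_ : 0 <= 2 * (n%:R + 6) + 9) kM; nra.
have [||k [tk hk]] := @golden_section_time _ _ _ eta 0 1 ler01 (24 * (M * n%:R)) _ _ h.
- by rewrite mulr_ge0 // mulr_ge0.
- by move=> a o' t' _; apply: inner.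
have kM : k.+1%:R <= M by apply: (passes k (1 - 0)) => //; lra.
apply: (le_trans tk).
have Mn : 1 <= M * n%:R by rewrite -[leLHS]mulr1 ler_pM.
apply: (@le_trans _ _ (M * (57 * (M * n%:R)))).
  by apply: ler_pM => //; lra.
by rewrite /M le_eqVlt; apply/orP; left; apply/eqP; ring.
Qed.

Theorem lemma2 (R : realType) (n m K N : nat)
    (X : set 'rV[R]_n) (Z : set 'rV[R]_m) (c : 'rV[R]_m -> 'rV[R]_m -> R)
    (ell : 'I_K -> 'rV[R]_n -> 'rV[R]_m -> R)
    (zhat : 'I_N -> 'rV[R]_m) (rho : R) (nrm : 'rV[R]_m -> R) (p : R)
    (x : 'rV[R]_n) (i : 'I_N) (b : R) (k1 k2 : 'I_K)
    (hc : transportation_cost Z c)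
    (hzhat : forall j, Z (zhat j))
    (hrho : 0 < rho)
    (hreg : regularity_assumption X Z c ell zhat rho nrm p)
    (hx : X x) (hb : 0 <= b) (hk : (k1 < k2)%N) :
  let l := fun k z => ell k x z in
  let zh := zhat i in
  let Vstar := pair_utility Z c (l k1) (l k2) zh b in
  [/\ (forall wco cost, wc_oracle Z c l wco cost ->
       forall eps eta : R, 0 < eps -> 0 < eta ->
         (exists o t, pair_eval wco cost eps eta zh k1 k2 b o t) /\
         (forall Vhat s t, pair_eval wco cost eps eta zh k1 k2 b (Vhat, s) t ->
            pair_feasible Z c zh b s)),
      (forall theta, error_exponent Z ell nrm p x theta ->
       exists2 C : R, 0 < C &
         forall wco cost, wc_oracle Z c l wco cost ->
         forall eps eta : R, 0 < eps -> 0 < eta ->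
         forall Vhat s t, pair_eval wco cost eps eta zh k1 k2 b (Vhat, s) t ->
           `|Vstar - Vhat| <= C * (eps + eta `^ theta))
    & (exists (C : R) (q : nat), 0 < C /\
         forall wco cost, wc_oracle Z c l wco cost ->
         forall eps eta : R, 0 < eps -> 0 < eta -> eta <= 2^-1 ->
         forall Vhat s t, pair_eval wco cost eps eta zh k1 k2 b (Vhat, s) t ->
           t%:R <= soft_O_bound C q
             ((cost k1 eps + cost k2 eps)%:R * (ln eta^-1) ^+ 2))].
Proof.
move=> l zh Vstar; have Zzh : Z zh := hzhat i.
have [_ c0 c_conv _] := hc.
have Z_conv z z' (t : R) : Z z -> Z z' -> 0 <= t <= 1 -> Z (t *: z + (1 - t) *: z').
  exact: convex_setE (reg_Z_convex hreg).
have cc z z' (t : R) : Z z -> Z z' -> 0 <= t <= 1 ->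
    c (t *: z + (1 - t) *: z') zh <= t * c z zh + (1 - t) * c z' zh.
  exact: convex_functionE (c_conv _ Zzh).
have lc k z z' (t : R) : 0 <= t <= 1 ->
    t * l k z + (1 - t) * l k z' <= l k (t *: z + (1 - t) *: z').
  exact: (reg_concave hreg).
split.
- move=> wco cost ho eps eta eps0 eta0; split; first exact: pair_eval_total.
  by move=> Vhat s t /(pair_eval_certified Zzh hb ho eps0) [].
- move=> theta ht.
  have [tau [sigma [[tau01 sigma01 theta0 th1 th2] hG]]] :=
    growth_exponents hreg Zzh ht.
  have [G1 G10 [g1 g1']] := hG k1; have [G2 G20 [g2 g2']] := hG k2.
  have G0 : 0 <= G1 + G2 by rewrite addr_ge0.
  have widen s k : k = k1 \/ k = k2 -> ball_growth Z c (l k1) zh G1 s ->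
      ball_growth Z c (l k2) zh G2 s -> ball_growth Z c (l k) zh (G1 + G2) s.
    move=> hk12 h1 h2 w u Zw cw u0.
    have P := powR_ge0 u s.
    case: hk12 => ->; [apply: le_trans (h1 w u Zw cw u0) _|apply: le_trans (h2 w u Zw cw u0) _];
      by rewrite lerD2l ler_wpM2r // ?lerDl ?lerDr.
  have gt k : k = k1 \/ k = k2 -> ball_growth Z c (l k) zh (G1 + G2) tau.
    by move=> hk12; apply: widen.
  have gs k : k = k1 \/ k = k2 -> ball_growth Z c (l k) zh (G1 + G2) sigma.
    by move=> hk12; apply: widen.
  pose E := 4 * ((G1 + G2) * (1 + b)) +
    (2 * (`|l k1 zh| + `|l k2 zh|) + (G1 + G2) * b `^ sigma * 2).
  have E0 : 0 <= E by rewrite !(mulr_ge0, addr_ge0) // powR_ge0.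
  exists (16 + E) => [|wco cost ho eps eta eps0 eta0 Vhat s t hs].
    by rewrite ltr_wpDr.
  have [fs /= Vs] := pair_eval_certified Zzh hb ho eps0 hs.
  have bound s' : pair_feasible Z c zh b s' ->
      pair_objective (l k1) (l k2) zh s' <= Vhat + (16 + E) * (eps + eta `^ theta).
    move=> fs'; apply: le_trans (pair_eval_precision Z_conv lc cc Zzh (c0 _ Zzh) hb
      ho eps0 eta0 G0 tau01 sigma01 theta0 th1 th2 gt gs hs fs') _.
    rewrite /= /inner_precision -addrA lerD2l.
    have := mulr_ge0 E0 (ltW eps0); have := powR_ge0 eta theta.
    rewrite /E; lra.
  have Vle : Vstar <= Vhat + (16 + E) * (eps + eta `^ theta).
    apply: ge_sup; first by exists (pair_objective (l k1) (l k2) zh s), s.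
    by move=> _ [s' fs' <-]; apply: bound.
  have Vge : Vhat <= Vstar.
    rewrite Vs; apply: ub_le_sup; last by exists s.
    by exists (Vhat + (16 + E) * (eps + eta `^ theta)) => _ [s' fs' <-]; apply: bound.
  by rewrite ger0_norm ?subr_ge0 // lerBlDl.
- have [C C0 hC] := @pair_eval_time R m K k1 k2 b hb.
  exists C, 0%N; split=> // wco cost ho eps eta eps0 eta0 eta2 Vhat s t hs.
  rewrite /soft_O_bound expr0 mulr1; apply: hC hs => //.
  by have [] := ho k1 eps eps0.
Qed.
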